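(* Let $I\subset\mathbb{R}$ be a closed finite interval with $|I|=1$. Assume $F\in C(\mathbb{T}^d\times\mathbb{R}^d\times I)$, $f\in C(\mathbb{T}^d\times I)$ and $k\in C(I\times I)$ with $0<k_0\le k\le k_1$, and suppose (A1)–(A5) hold. For $\alpha>0$ let $v^\alpha\in C(\mathbb{T}^d\times I)$ be the viscosity solution of $$\alpha v^\alpha(x,\xi)+F(x,Dv^\alpha(x,\xi),\xi)+\int_I k(\xi,\eta)\big(v^\alpha(x,\xi)-v^\alpha(x,\eta)\big)\,d\eta=f(x,\xi)\quad\text{in }\mathbb{T}^d\times I.$$ Then there exists $v\in C(\mathbb{T}^d\times I)$, a viscosity solution of $$F(x,Dv(x,\xi),\xi)+\int_I k(\xi,\eta)\big(v(x,\xi)-v(x,\eta)\big)\,d\eta=f(x,\xi)\quad\text{in }\mathbb{T}^d\times I,$$ such that $v^\alpha\to v$ uniformly on $\mathbb{T}^d\times I$ as $\alpha\to0$.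
   Context: Viscosity solutions are defined with test functions $\phi\in C^1(\mathbb{T}^d)$ touching $v(\cdot,\xi)$ for fixed $\xi$ from above (subsolution inequality $\le$) or below (supersolution inequality $\ge$). Assumptions: (A1) $C_1|p|^m-C_2\le F(x,p,\xi)$ for constants $C_1,C_2>0$, $m>1$. (A2) $f\ge0$ and $\mathcal{A}:=\{x\in\mathbb{T}^d: f(x,\xi)=0\ \forall\xi\in I\}\neq\emptyset$. (A3) $p\mapsto F(x,p,\xi)$ convex. (A4) $F\ge0$, $F(x,0,\xi)=0$. (A5) modulus $\omega$ with $|f(x,\xi)-f(y,\xi)|\le\omega(|x-y|)$; for each $R>0$ modulus $\omega_R$ with $|F(x,p,\xi)-F(y,q,\xi)|\le\omega_R(|x-y|+|p-q|)$ for $p,q\in B(0,R)$, uniformly in $\xi$. *)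

(* Defs.v *)
From HB Require Import structures.
From mathcomp Require Import all_boot all_order all_algebra.
From mathcomp Require Import all_classical all_reals all_analysis.
Set Implicit Arguments. Unset Strict Implicit. Unset Printing Implicit Defensive.
Import Order.TTheory GRing.Theory Num.Theory.
Import numFieldNormedType.Exports.
Local Open Scope classical_set_scope.
Local Open Scope ring_scope.

Section Defs.
Variables (R : realType) (d : nat).
Notation vec := 'rV[R]_d.

Definition enorm (p : vec) : R := Num.sqrt (\sum_(i < d) (p ord0 i) ^+ 2).

Definition zvec (n : 'rV[int]_d) : vec := map_mx (fun z : int => z%:~R) n.

(* Z^d-zperiodic in the space variable: functions on the torus T^d *)
Definition zperiodic (g : vec -> R) : Prop :=
  forall (x : vec) (n : 'rV[int]_d), g (x + zvec n) = g x.

Definition inI (a xi : R) : Prop := a <= xi <= a + 1.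

Definition grad (phi : vec -> R) (x : vec) : vec :=
  \row_(i < d) ('D_(delta_mx ord0 i) phi x).

Definition C1_torus (phi : vec -> R) : Prop :=
  zperiodic phi /\ (forall x, differentiable phi x) /\ continuous (grad phi).

Definition C_TI (a : R) (v : vec -> R -> R) : Prop :=
  (forall xi, zperiodic (v ^~ xi)) /\
  {within [set p : vec * R | inI a p.2], continuous (fun p => v p.1 p.2)}.

Definition is_modulus (w : R -> R) : Prop :=
  w 0 = 0 /\ (forall r, 0 <= r -> 0 <= w r) /\
  (forall r s, 0 <= r -> r <= s -> w r <= w s) /\
  (w r @[r --> 0^'+] --> 0).

Definition nonloc (a : R) (k : R -> R -> R) (v : vec -> R -> R) (x : vec) (xi : R) : R :=
  Rintegral (@lebesgue_measure R) `[a, a + 1]%classic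
    (fun eta => k xi eta * (v x xi - v x eta)).

Definition visc_sub (a alpha : R) (F : vec -> vec -> R -> R) (k : R -> R -> R)
  (f : vec -> R -> R) (v : vec -> R -> R) : Prop :=
  forall (xi : R) (phi : vec -> R) (x0 : vec), inI a xi -> C1_torus phi ->
    (\forall y \near x0, v y xi - phi y <= v x0 xi - phi x0) ->
    alpha * v x0 xi + F x0 (grad phi x0) xi + nonloc a k v x0 xi <= f x0 xi.

Definition visc_super (a alpha : R) (F : vec -> vec -> R -> R) (k : R -> R -> R)
  (f : vec -> R -> R) (v : vec -> R -> R) : Prop :=
  forall (xi : R) (phi : vec -> R) (x0 : vec), inI a xi -> C1_torus phi ->
    (\forall y \near x0, v x0 xi - phi x0 <= v y xi - phi y) ->
    alpha * v x0 xi + F x0 (grad phi x0) xi + nonloc a k v x0 xi >= f x0 xi.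

Definition visc_sol a alpha F k f v : Prop :=
  C_TI a v /\ visc_sub a alpha F k f v /\ visc_super a alpha F k f v.

Definition A1 (a : R) (F : vec -> vec -> R -> R) : Prop :=
  exists C1 C2 m : R, 0 < C1 /\ 0 < C2 /\ 1 < m /\
    forall x p xi, inI a xi -> C1 * powR (enorm p) m - C2 <= F x p xi.

Definition A2 (a : R) (f : vec -> R -> R) : Prop :=
  (forall x xi, inI a xi -> 0 <= f x xi) /\
  (exists x : vec, forall xi, inI a xi -> f x xi = 0).

Definition A3 (a : R) (F : vec -> vec -> R -> R) : Prop :=
  forall x xi (p q : vec) (t : R), inI a xi -> 0 <= t <= 1 ->
    F x (t *: p + (1 - t) *: q) xi <= t * F x p xi + (1 - t) * F x q xi.

Definition A4 (a : R) (F : vec -> vec -> R -> R) : Prop :=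
  forall x p xi, inI a xi -> 0 <= F x p xi /\ F x 0 xi = 0.

Definition A5 (a : R) (F : vec -> vec -> R -> R) (f : vec -> R -> R) : Prop :=
  (exists w, is_modulus w /\
     forall x y xi, inI a xi -> `|f x xi - f y xi| <= w (enorm (x - y))) /\
  (forall Rad : R, 0 < Rad -> exists w, is_modulus w /\
     forall x y p q xi, inI a xi -> enorm p < Rad -> enorm q < Rad ->
       `|F x p xi - F y q xi| <= w (enorm (x - y) + enorm (p - q))).

End Defs.

(* Main.v *)
(** As [alpha] decreases the solutions [v^alpha] increase, because [v^alpha >= 0] makes
    [v^beta] a subsolution of the [alpha]-equation whenever [alpha <= beta].  On the zero set
    of [f] the inequality [F >= 0] forces [v^alpha = 0]; together with the superlinear
    coercivity of [F], which bounds the Lipschitz constant in [x] by a small multiple of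
    [max v^alpha] plus a constant, this bounds [v^alpha] and its Lipschitz constant uniformly.
    Freezing the nonlocal term, comparison of the scalar equations at [xi] and [eta], whose
    zeroth order coefficient is at least [k0], gives equicontinuity in [xi].  So the monotone
    limit is continuous, the convergence is uniform (Dini), and the limit solves the equation by
    stability.

    Test functions have to be periodic, so [perdist z = sum_i (1 - cos (2 pi z_i))] replaces
    [|z|^2] both in the doubling of variables and in the localization of maxima. *)

Require Import Defs.
From HB Require Import structures.
From mathcomp Require Import all_boot all_order all_algebra.
From mathcomp Require Import all_classical all_reals all_analysis.
From mathcomp Require Import ring lra.
Import Order.TTheory GRing.Theory Num.Theory.
Import numFieldNormedType.Exports.
Local Open Scope classical_set_scope.
Local Open Scope ring_scope.

Set Implicit Arguments. Unset Strict Implicit.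

(** * Elementary continuity and trigonometric facts *)

Lemma continuous_mull (R : realType) (T : topologicalType) (c : R) (h : T -> R) :
  continuous h -> continuous (fun t => c * h t).
Proof.
by move=> ch x; have := @continuousM _ _ (cst c) h x (@cst_continuous _ _ _ x) (ch x).
Qed.

Lemma continuous_sub (R : realType) (T : topologicalType) (V : normedModType R) (h k : T -> V) :
  continuous h -> continuous k -> continuous (fun t => h t - k t).
Proof. by move=> ch ck x; have := @continuousB _ _ _ h k x (ch x) (ck x). Qed.

Lemma continuous_add (R : realType) (T : topologicalType) (V : normedModType R) (h k : T -> V) :
  continuous h -> continuous k -> continuous (fun t => h t + k t).
Proof. by move=> ch ck x; have := @continuousD _ _ _ h k x (ch x) (ck x). Qed.

Lemma cos_addz (R : realType) (t : R) (m : int) :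
  cos (2 * pi * (t + m%:~R)) = cos (2 * pi * t).
Proof.
case: m => n.
  elim: n t => [|n IH] t; first by rewrite addr0.
  rewrite -(IH t) -[LHS](_ : cos (2 * pi * (t + n%:~R) + pi *+ 2) = _).
    by rewrite cosD2pi.
  by congr cos; rewrite -[in RHS]natr1; ring.
(* [Negz n] stands for -(n + 1), so the base case is already a shift by -1. *)
elim: n t => [|n IH] t.
  by rewrite -[LHS]cosD2pi; congr cos; rewrite NegzE; ring.
by rewrite -(IH t) -[LHS]cosD2pi; congr cos; rewrite !NegzE -[in LHS]natr1; ring.
Qed.

Lemma ler_norm_sin (R : realType) (t : R) : `|sin t| <= `|t|.
Proof.
have H (s : R) : 0 <= s -> `|sin s| <= s.
  rewrite le_eqVlt => /predU1P[<-|s0]; first by rewrite sin0 normr0.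
  have [x x01] : exists2 x, x \in `]0, s[ & sin s - sin 0 = cos x * (s - 0) :> R.
    apply: MVT => //; apply: continuous_subspaceT => x; exact: continuous_sin.
  rewrite sin0 !subr0 => ->; rewrite normrM (gtr0_norm s0).
  by apply: ler_piMl; [exact: ltW | exact: cos_max].
have [t0|/ltW t0] := leP 0 t; first by rewrite (ger0_norm t0); exact: H.
rewrite (ler0_norm t0) -normrN -sinN; apply: H; lra.
Qed.

(** * The periodic penalty: size, localization modulo the lattice, gradient *)

Section Penalty.
Variables (R : realType) (d : nat).
Notation vec := 'rV[R]_d.
Implicit Types (x y z : vec) (n : 'rV[int]_d).

Lemma norm_coord x i : `|x ord0 i| <= `|x|.
Proof.
rewrite [leRHS]/Num.Def.normr/= mx_normrE.
exact: (le_bigmax _ (fun ij => `|x ij.1 ij.2|) (ord0, i)).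
Qed.

Lemma norm_le_coord x (e : R) : 0 <= e -> (forall i, `|x ord0 i| <= e) -> `|x| <= e.
Proof.
move=> e0 H; rewrite [leLHS]/Num.Def.normr/= mx_normrE; apply: bigmax_le => //= -[j i] _ /=.
by rewrite [j]ord1; exact: H.
Qed.

Lemma norm_coord_enorm x i : `|x ord0 i| <= enorm x.
Proof.
rewrite -sqrtr_sqr /enorm ler_sqrt; last by apply: sumr_ge0 => *; exact: sqr_ge0.
by rewrite (bigD1 i)//= lerDl; apply: sumr_ge0 => *; exact: sqr_ge0.
Qed.

Lemma enorm_ge0 x : 0 <= enorm x.
Proof. exact: sqrtr_ge0. Qed.

(* A smooth [Z^d]-periodic substitute for [|z|^2]: an admissible test function. *)
Definition perdist z : R := \sum_(i < d) (1 - cos (2 * pi * z ord0 i)).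

Lemma perdist_ge0 z : 0 <= perdist z.
Proof. by apply: sumr_ge0 => i _; rewrite subr_ge0 cos_le1. Qed.

Lemma perdist0 : perdist 0 = 0.
Proof. by rewrite /perdist big1// => i _; rewrite mxE mulr0 cos0 subrr. Qed.

Lemma perdist_coord z i : 1 - cos (2 * pi * z ord0 i) <= perdist z.
Proof.
rewrite /perdist (bigD1 i)//= lerDl; apply: sumr_ge0 => j _.
by rewrite subr_ge0 cos_le1.
Qed.

Lemma perdistN z : perdist (- z) = perdist z.
Proof. by apply: eq_bigr => i _; rewrite mxE mulrN cosN. Qed.

Lemma perdistDz z n : perdist (z + zvec R n) = perdist z.
Proof. by apply: eq_bigr => i _; rewrite !mxE cos_addz. Qed.

(** From 1 - cos(2s) = 2 sin^2 s and |sin s| <= |s|. The norm is the sup norm, and the crude factor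
    [d.+1] in place of sqrt d keeps the constant positive even for d = 0. *)
Lemma perdist_le z : perdist z <= (d.+1%:R * (2 * pi) * `|z|) ^+ 2.
Proof.
apply: (@le_trans _ _ (\sum_(i < d) ((2 * pi) * `|z|) ^+ 2)).
  apply: ler_sum => i _.
  have -> : 2 * pi * z ord0 i = (pi * z ord0 i) *+ 2 by rewrite -mulr_natr; ring.
  rewrite cos_mulr2n cos2sin2.
  have -> (s : R) : 1 - ((1 - s) *+ 2 - 1) = 2 * s by ring.
  have := ler_norm_sin (pi * z ord0 i).
  rewrite normrM (gtr0_norm (pi_gt0 R)) => h1.
  have h2 : `|sin (pi * z ord0 i)| <= pi * `|z|.
    by apply: le_trans h1 _; rewrite ler_pM2l ?pi_gt0// norm_coord.
  rewrite -real_normK ?num_real//.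
  have h3 : `|sin (pi * z ord0 i)| ^+ 2 <= (pi * `|z|) ^+ 2.
    by rewrite lerXn2r ?nnegrE// mulr_ge0 ?pi_ge0.
  have : 0 <= (pi * `|z|) ^+ 2 by exact: sqr_ge0.
  have -> : (2 * pi * `|z|) ^+ 2 = 4 * (pi * `|z|) ^+ 2 by ring.
  lra.
rewrite sumr_const card_ord -[in leRHS]mulrA [in leRHS]exprMn -[leLHS]mulr_natl ler_wpM2r ?sqr_ge0//.
rewrite -natrX ler_nat; apply: (@leq_trans d.+1) => //.
by rewrite expnS expn1 leq_pmulr.
Qed.

Lemma ex_shift01 x : exists n, forall i, 0 <= (x + zvec R n) ord0 i <= 1.
Proof.
exists (\row_i - Num.floor (x ord0 i)) => i; rewrite !mxE mulrNz.
by have /andP[] := floor_itv (x ord0 i); rewrite intrD; lra.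
Qed.

Lemma ex_shift_half x : exists n, forall i, `|(x + zvec R n) ord0 i| <= 1 / 2.
Proof.
exists (\row_i - Num.floor (x ord0 i + 1 / 2)) => i; rewrite !mxE mulrNz ler_norml.
by have /andP[] := floor_itv (x ord0 i + 1 / 2); rewrite intrD; lra.
Qed.

(** Cosine is strictly decreasing on [0, pi], and coordinates of size at most 1/2 are those for
    which 2 pi |z_i| stays in that interval. *)
Lemma perdist_small_half (e : R) : 0 < e -> exists2 c : R, 0 < c &
  forall z, (forall i, `|z ord0 i| <= 1 / 2) -> perdist z < c -> `|z| < e.
Proof.
move=> e0; pose t : R := Num.min (1 / 4) (e / 2).
have t0 : 0 < t by rewrite lt_min; apply/andP; split; lra.
have t4 : t <= 1 / 4 by rewrite ge_min lexx.
have te : t <= e / 2 by rewrite ge_min lexx orbT.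
have p0 := pi_gt0 R.
have tI : 2 * pi * t \in `[0, pi].
  by rewrite in_itv/=; apply/andP; split; [rewrite !mulr_ge0 ?ltW | nra].
exists (1 - cos (2 * pi * t)).
  rewrite subr_gt0 -[ltRHS](cos0 R) ltr_cos//; first by rewrite !mulr_gt0.
  by rewrite in_itv/= lexx ltW.
move=> z zh zc; apply: (@le_lt_trans _ _ t); last lra.
apply: norm_le_coord => [|i]; first exact: ltW.
rewrite leNgt; apply/negP => ti.
have := le_lt_trans (perdist_coord z i) zc; rewrite ltrD2l ltrN2 ltNge => /negP; apply.
rewrite -[cos (_ * z ord0 i)]cos_norm normrM (@ger0_norm _ (2 * pi)); last lra.
have rI : 2 * pi * `|z ord0 i| \in `[0, pi].
  have := zh i; have := normr_ge0 (z ord0 i); move: (`|z ord0 i|) => r r0 r2.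
  rewrite in_itv/=; apply/andP; split; first by rewrite !mulr_ge0// ltW.
  by rewrite mulrAC -[leRHS]mul1r ler_pM2r//; lra.
by apply: ltW; rewrite ltr_cos// ltr_pM2l// mulr_gt0.
Qed.

(** The penalty sees [z] only modulo the lattice, so smallness of [z] is recovered up to an integer
    shift. *)
Lemma perdist_small (e : R) : 0 < e -> exists2 c : R, 0 < c &
  forall z, perdist z < c -> exists n, `|z + zvec R n| < e.
Proof.
move=> /perdist_small_half[c c0 H]; exists c => // z zc.
have [n zn] := ex_shift_half z; exists n; apply: H => //.
by rewrite perdistDz.
Qed.

Lemma differentiable_trig (g : R -> R) (c : R) x y i :
    (forall t, derivable g t 1) ->
  differentiable (fun z => g (c * (z - x) ord0 i)) y /\
  forall v, 'd (fun z => g (c * (z - x) ord0 i)) y v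
    = c * v ord0 i * g^`()%classic (c * (y - x) ord0 i).
Proof.
move=> dg.
pose l z : R := c * (z - x) ord0 i.
have El : l = (c \*: (fun z => z ord0 i)) + cst (- c * x ord0 i).
  by apply/funext => z; rewrite /l fctE /= !mxE; rewrite /GRing.scale/=; ring.
have dc : differentiable (fun z : vec => z ord0 i : R) y by exact: differentiable_coord.
have dl : differentiable l y.
  by rewrite El; apply: differentiableD => //; exact: differentiableZ.
have dgl : differentiable g (l y) by exact/derivable1_diffP.
split; first by have := differentiable_comp dl dgl.
move=> v; rewrite (_ : (fun z => g _) = g \o l)// (diff_comp dl dgl)/= diff1E//.
suff -> : 'd l y v = c * v ord0 i by [].
have dZ : differentiable (c \*: (fun z : vec => z ord0 i : R)) y by exact: differentiableZ.
have dcE : 'd (fun z : vec => z ord0 i : R) y v = v ord0 i.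
  (* The coordinate is packaged as a linear map, which is its own differential. *)
  have @f : {linear vec -> R}.
    by exists (fun z : vec => z ord0 i); do 2![eexists]; do ?[constructor];
      rewrite ?mxE// => ? *; rewrite ?mxE//; move=> ?; rewrite !mxE.
  by rewrite (_ : (fun _ => _) = f)// diff_lin//; exact: coord_continuous.
by rewrite El diffD//= diff_cst diffZ//= addr0 dcE.
Qed.

Lemma continuous_row (T : topologicalType) (h : T -> vec) :
  (forall i, continuous (fun t => h t ord0 i)) -> continuous h.
Proof.
move=> H t; apply/cvgrPdist_le => e e0.
have : \forall s \near t, forall i, `|h t ord0 i - h s ord0 i| <= e.
  by apply: filter_forall => i; have /cvgrPdist_le := H i t; exact.
apply: filterS => s hs; apply: norm_le_coord => [|i]; first exact: ltW.
by rewrite !mxE; exact: hs.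
Qed.

Lemma C1_torusD (phi psi : vec -> R) : C1_torus phi -> C1_torus psi ->
  C1_torus (fun y => phi y + psi y) /\
  forall x, grad (fun y => phi y + psi y) x = grad phi x + grad psi x.
Proof.
move=> [p1 [d1 c1]] [p2 [d2 c2]].
have E x : grad (fun y => phi y + psi y) x = grad phi x + grad psi x.
  by apply/rowP => i; rewrite !mxE deriveD//; exact: diff_derivable.
split; last exact: E.
split; first by move=> x n; rewrite p1 p2.
split; first by move=> x; exact: differentiableD.
have -> : grad (fun y => phi y + psi y) = (fun x => grad phi x + grad psi x) by exact/funext.
exact: continuous_add.
Qed.

Lemma C1_torusN (phi : vec -> R) : C1_torus phi ->
  C1_torus (fun y => - phi y) /\ forall x, grad (fun y => - phi y) x = - grad phi x.
Proof.
move=> [p1 [d1 c1]].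
have E x : grad (fun y => - phi y) x = - grad phi x.
  by apply/rowP => i; rewrite !mxE deriveN//; exact: diff_derivable.
split; last exact: E.
split; first by move=> x n; rewrite p1.
split; first by move=> x; exact: differentiableN.
have -> : grad (fun y => - phi y) = (fun x => - grad phi x) by exact/funext.
by move=> x; apply: (@continuousN _ _ _ (grad phi)); exact: c1.
Qed.

(** The gradient of [perdist] in closed form, as [grad_perdist] shows. *)
Definition dperdist z : vec := \row_i (2 * pi * sin (2 * pi * z ord0 i)).

Lemma dperdistN z : dperdist (- z) = - dperdist z.
Proof. by apply/rowP => i; rewrite !mxE mulrN sinN mulrN. Qed.

Lemma dperdist0 : dperdist 0 = 0.
Proof. by apply/rowP => i; rewrite !mxE mulr0 sin0 mulr0. Qed.

Lemma continuous_dperdist x0 : continuous (fun y => dperdist (y - x0)).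
Proof.
apply: continuous_row => i.
have -> : (fun t => dperdist (t - x0) ord0 i) =
          (fun y => 2 * pi * sin (2 * pi * (y ord0 i - x0 ord0 i))).
  by apply/funext => y; rewrite !mxE.
have cB : continuous (fun y : vec => y ord0 i - x0 ord0 i).
  by apply: continuous_sub; [exact: coord_continuous | exact: cst_continuous].
apply: continuous_mull => x.
by apply: (continuous_comp (@continuous_mull _ _ (2 * pi) _ cB x)); exact: continuous_sin.
Qed.

(** Each penalty of the doubling argument has this form; [c] is negative when the function is
    touched from below. *)
Lemma grad_perdist (c : R) x0 : C1_torus (fun y => c * perdist (y - x0)) /\
  forall x, grad (fun y => c * perdist (y - x0)) x = c *: dperdist (x - x0).
Proof.
pose h i (y : vec) : R := c * (1 - cos (2 * pi * (y - x0) ord0 i)).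
have Eh : (fun y => c * perdist (y - x0)) = \sum_(i < d) h i.
  by apply/funext => y; rewrite fct_sumE /perdist mulr_sumr.
have hE i : h i = c \*: (cst 1 - (fun y => cos (2 * pi * (y - x0) ord0 i))).
  by apply/funext.
have dcos i y : differentiable (fun y => cos (2 * pi * (y - x0) ord0 i)) y.
  by have [] := @differentiable_trig cos (2 * pi) x0 y i (@derivable_cos R).
have dh i y : differentiable (h i) y.
  by rewrite hE; apply: differentiableZ; apply: differentiableB.
have E x : grad (fun y => c * perdist (y - x0)) x = c *: dperdist (x - x0).
  apply/rowP => i; rewrite mxE Eh derive_sum; last by move=> j; exact: diff_derivable.
  have Ej j v : 'D_v (h j) x = c * (2 * pi * v ord0 j * sin (2 * pi * (x - x0) ord0 j)).
    rewrite deriveE// hE diffZ/=; last exact: differentiableB.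
    rewrite diffB//= diff_cst.
    have [_ ->] := @differentiable_trig cos (2 * pi) x0 x j (@derivable_cos R).
    by rewrite derive1E derive_val /GRing.scale/= [X in c * (X - _)](_ : _ = 0)//; ring.
  rewrite (bigD1 i)//= big1 ?addr0 => [|j ji]; rewrite Ej !mxE ?eqxx/=.
    by rewrite mulr1.
  by rewrite (negbTE ji) mulr0 mul0r mulr0.
split; last exact: E.
split; first by move=> x n; rewrite addrAC perdistDz.
split; first by move=> x; rewrite Eh; exact: differentiable_sum.
have -> : grad (fun y => c * perdist (y - x0)) = (fun x => c *: dperdist (x - x0)) by exact/funext.
by move=> x; apply: (@continuousZl_tmp _ _ _ (fun x => dperdist (x - x0))); exact: continuous_dperdist.
Qed.

Lemma continuous_perdist : continuous perdist.
Proof.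
move=> x; apply: differentiable_continuous.
have [[_ [/(_ x)]]] := grad_perdist 1 0.
by under eq_fun do rewrite subr0 mul1r.
Qed.

(* |grad perdist|^2 = (2 pi)^2 sum (1 - c_i)(1 + c_i) with c_i the cosines, which are
   nonnegative as soon as perdist <= 1 *)
Lemma perdist_le_dperdist z : perdist z <= 1 -> perdist z <= enorm (dperdist z) ^+ 2.
Proof.
move=> z1; rewrite /enorm sqr_sqrtr; last by apply: sumr_ge0 => *; exact: sqr_ge0.
apply: ler_sum => i _; rewrite mxE.
have := le_trans (perdist_coord z i) z1; have := cos_le1 (2 * pi * z ord0 i).
rewrite exprMn sin2cos2; move: (cos _) => c c1 c0.
have p4 : 1 <= (2 * pi) ^+ 2 :> R by apply: exprn_ege1; have := pi_ge2 R; lra.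
apply: (@le_trans _ _ (1 * (1 - c ^+ 2))); last by rewrite ler_wpM2r//; nra.
nra.
Qed.

End Penalty.

(** * Uniform continuity and maxima by compactness *)

Lemma within_continuous_precomp (X Y Z : topologicalType) (S : set Y) (g : Y -> Z)
    (c : X -> Y) : continuous c -> (forall x, S (c x)) ->
  {within S, continuous g} -> continuous (fun x => g (c x)).
Proof.
move=> cc cS cg x A /(cg (c x)); rewrite /nbhs/= -nbhs_subspace_in; last exact: cS.
by move=> /(cc x); rewrite /nbhs/=; apply: filterS => y /=; apply; exact: cS.
Qed.

(** Only [x] is confined to [K]. For a periodic function a common translation puts [x] into the unit
    box, while [y] may fall outside it. *)
Lemma compact_unif_continuous (R : realType) (X : normedModType R) (K : set X) (g : X -> R) :
  compact K -> continuous g -> forall e : R, 0 < e -> exists2 r : R, 0 < r &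
  forall x y, K x -> `|x - y| < r -> `|g x - g y| < e.
Proof.
move=> /compact_near_coveringP cK cg e e0.
have : \forall r \near (0 : R)^'+,
    0 < r /\ K `<=` [set x | forall y, `|x - y| < r -> `|g x - g y| < e].
  apply: filterI; first exact: nbhs_right_gt.
  apply: (cK R (0^'+) (fun r x => forall y, `|x - y| < r -> `|g x - g y| < e) _) => x Kx.
  have /cvgrPdist_lt/(_ (e / 2)) := cg x.
  rewrite divr_gt0// => /(_ isT)/nbhs_normP[s /= s0 sx].
  exists ([set x' | `|x - x'| < s / 2], [set r : R | r < s / 2]) => /=.
    split; last by apply: nbhs_right_lt; rewrite divr_gt0.
    by apply/nbhs_normP; exists (s / 2) => //=; rewrite divr_gt0.
  move=> [x' r] [/= xx' rs] y x'y.
  have h1 : `|g x - g x'| < e / 2 by apply: sx => /=; lra.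
  have h2 : `|g x - g y| < e / 2.
    by apply: sx => /=; have := ler_distD x' x y; lra.
  by have := ler_distD (g x) (g x') (g y); rewrite (distrC (g x') (g x)); lra.
by move=> /filter_ex[r [r0 H]]; exists r => // x y Kx; exact: H.
Qed.

(** [K] acts as a fundamental domain, both for lattice translations and for truncation to the
    interval. *)
Lemma max_of_compact_orbits (R : realType) (X : topologicalType) (K : set X) (g : X -> R) :
  compact K -> continuous g -> K !=set0 -> (forall x, exists2 y, K y & g y = g x) ->
  exists2 x0, K x0 & forall x, g x <= g x0.
Proof.
move=> cK cg K0 H.
have [x0 x0K Hm] := compact_EVT_max K0 cK (continuous_subspaceT cg).
exists x0; first by rewrite inE in x0K.
by move=> x; have [y Ky <-] := H x; apply: Hm; rewrite inE.
Qed.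

(** * Truncation to the interval *)

Section Clamp.
Variable R : realType.
Implicit Types a xi : R.

(* Precomposing with [clamp a] turns continuity within [a, a + 1] into continuity on [R]. *)
Definition clamp a xi : R := Num.max a (Num.min xi (a + 1)).

Lemma inI_clamp a xi : inI a (clamp a xi).
Proof.
rewrite /inI /clamp le_max lexx/= ge_max ge_min lexx orbT andbT; lra.
Qed.

Lemma clamp_id a xi : inI a xi -> clamp a xi = xi.
Proof.
by move=> /andP[h1 h2]; rewrite /clamp (min_idPl _)// (max_idPr _).
Qed.

Lemma continuous_clamp a : continuous (clamp a).
Proof.
move=> x; apply: (@continuous_max _ _ (cst a) (fun x => Num.min x (a + 1))).
  exact: cst_continuous.
by apply: (@continuous_min _ _ id (cst (a + 1))); [exact: id | exact: cst_continuous].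
Qed.

End Clamp.

(** * Periodic functions: doubling of variables, Lipschitz bounds, comparison *)

Section Periodic.
Variables (R : realType) (d : nat).
Notation vec := 'rV[R]_d.
Implicit Types (x y z : vec) (u w : vec -> R) (phi : vec -> R).

Definition unit_box : set vec := [set x | forall i, `[0, 1]%classic (x ord0 i)].

Lemma compact_unit_box : compact unit_box.
Proof. by apply: (@rV_compact R d (fun=> `[0, 1]%classic)) => i; exact: segment_compact. Qed.

Lemma unit_box_shift x : exists n, unit_box (x + zvec R n).
Proof.
by have [n H] := ex_shift01 x; exists n => i /=; rewrite in_itv/=; exact: H.
Qed.

Lemma unit_box0 : unit_box 0.
Proof. by move=> i /=; rewrite mxE in_itv/= lexx ler01. Qed.

Lemma periodic_unif_continuous u : continuous u -> zperiodic u ->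
  forall e : R, 0 < e -> exists2 r : R, 0 < r &
  forall x y, `|x - y| < r -> `|u x - u y| < e.
Proof.
move=> cu pu e e0.
have [r r0 H] := compact_unif_continuous compact_unit_box cu e0.
exists r => // x y xy; have [n nx] := unit_box_shift x.
rewrite -(pu x n) -(pu y n); apply: H => //.
by rewrite opprD addrACA subrr addr0.
Qed.

Lemma periodic_max u : continuous u -> zperiodic u -> exists x0, forall x, u x <= u x0.
Proof.
move=> cu pu; have [] := max_of_compact_orbits compact_unit_box cu.
- by exists 0; exact: unit_box0.
- by move=> x; have [n nx] := unit_box_shift x; exists (x + zvec R n).
- by move=> x0 _ H; exists x0.
Qed.

(** The penalized difference is invariant under separate lattice shifts of the two variables up to
    the shift inside [perdist], so the maximum is attained on a product of boxes. [N0] is the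
    oscillation of [u] plus one, over the threshold [c] of [perdist_small]. *)
Lemma doubling_max u w : continuous u -> zperiodic u -> continuous w -> zperiodic w ->
  forall e : R, 0 < e -> exists2 N0 : R, 0 < N0 & forall N : R, N0 <= N ->
  exists x y, `|x - y| < e /\ forall x' y',
    u x' - w y' - N * perdist (x' - y') <= u x - w y - N * perdist (x - y).
Proof.
move=> cu pu cw pw e e0.
have [c c0 Hc] := perdist_small d e0.
have [x1 H1] := periodic_max cu pu.
have [x2 H2] : exists x0, forall x, u x0 <= u x.
  have [||x0 H0] := @periodic_max (fun x => - u x).
  - by move=> x; apply: continuousN; exact: cu.
  - by move=> x n; rewrite pu.
  - by exists x0 => x; rewrite -lerN2.
have N0 : 0 < (u x1 - u x2 + 1) / c by rewrite divr_gt0//; have := H1 x2; lra.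
exists ((u x1 - u x2 + 1) / c) => // N hN.
pose g (p : vec * vec) := u p.1 - w p.2 - N * perdist (p.1 - p.2).
have cg : continuous g.
  apply: continuous_sub; first apply: continuous_sub.
  - by move=> p; apply: (continuous_comp cvg_fst); exact: cu.
  - by move=> p; apply: (continuous_comp cvg_snd); exact: cw.
  have cB : continuous (fun p : vec * vec => p.1 - p.2).
    by apply: continuous_sub => p; [exact: cvg_fst | exact: cvg_snd].
  by apply: continuous_mull => p; apply: (continuous_comp (cB p)); exact: continuous_perdist.
have [||[x y] _ Hm] := max_of_compact_orbits (compact_setX compact_unit_box compact_unit_box) cg.
- by exists (0, 0); split; exact: unit_box0.
- move=> [x y]; have [n nx] := unit_box_shift x; have [m my] := unit_box_shift y.
  exists (x + zvec R n, y + zvec R m) => //=; rewrite /g/= pu pw.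
  have -> : x + zvec R n - (y + zvec R m) = x - y + zvec R (n - m).
    by apply/rowP => i; rewrite !mxE rmorphB/=; ring.
  by rewrite perdistDz.
(* Comparison with the diagonal point (y, y) bounds the penalty at the maximum by the oscillation of
   [u], which is below N c. *)
have /Hc[n xyn] : perdist (x - y) < c.
  have := Hm (y, y); rewrite /g/= subrr perdist0 => h.
  have Nc : u x1 - u x2 + 1 <= N * c by rewrite -ler_pdivrMr.
  have Np : 0 < N by exact: lt_le_trans N0 hN.
  by rewrite -(ltr_pM2l Np); have := H1 x; have := H2 y; lra.
exists (x + zvec R n), y; split; first by rewrite addrAC.
by move=> x' y'; rewrite pu (addrAC x) perdistDz; exact: (Hm (x', y')).
Qed.

Lemma enorm_sqr x : enorm x ^+ 2 = \sum_(i < d) (x ord0 i) ^+ 2.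
Proof. by rewrite sqr_sqrtr//; apply: sumr_ge0 => *; exact: sqr_ge0. Qed.

Lemma enormZ_sqr (c : R) x : enorm (c *: x) ^+ 2 = c ^+ 2 * enorm x ^+ 2.
Proof.
by rewrite !enorm_sqr mulr_sumr; apply: eq_bigr => i _; rewrite mxE exprMn.
Qed.

(** The viscosity form of |Du| <= G, tested at global maxima only, since the doubling argument
    produces such points. *)
Definition visc_grad_le u (G : R) := forall phi x0, C1_torus phi ->
  (forall y, u y - phi y <= u x0 - phi x0) -> enorm (grad phi x0) <= G.

Lemma perdist_pen_touch u w (N : R) x y :
  (forall x' y', u x' - w y' - N * perdist (x' - y') <= u x - w y - N * perdist (x - y)) ->
  (forall x', u x' - N * perdist (x' - y) <= u x - N * perdist (x - y)) /\
  (forall y', w y - - N * perdist (y - x) <= w y' - - N * perdist (y' - x)).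
Proof.
move=> H; split=> [x'|y']; first by have := H x' y; lra.
have := H x y'; rewrite -(perdistN (x - y)) -(perdistN (x - y')) !opprB; lra.
Qed.

(** By [perdist_le], sqrt(perdist z) <= kap |z|. *)
Let kap : R := d.+1%:R * (2 * pi).

Let kap_gt0 : 0 < kap.
Proof. by rewrite !mulr_gt0// pi_gt0. Qed.

(* With N = 2 G / r the maximum point (x, y) of u x - u y - N perdist (x - y) satisfies
   perdist (x - y) <= (r / 2)^2, so the modulus om of u with respect to sqrt perdist
   obeys om r <= 2 G r + om (r / 2). *)
Lemma visc_grad_le_small u (G : R) : continuous u -> zperiodic u -> 0 < G ->
  visc_grad_le u G -> exists2 r0 : R, 0 < r0 & forall r x y, 0 < r -> r <= r0 ->
  perdist (x - y) <= r ^+ 2 -> u x - u y <= 4 * G * r.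
Proof.
move=> cu pu G0 uG.
(* A maximum point with |a - b| < 1 / kap has perdist (a - b) <= 1, as [perdist_le_dperdist]
   requires. *)
have k0 : 0 < kap^-1 by rewrite invr_gt0.
have [N0 N00 HN] := doubling_max cu pu cu pu k0.
(* For s at most this radius, the weight 2 G / s is at least [N0]. *)
exists (2 * G / N0) => [|r x y r0 rr0 xyr]; first by rewrite divr_gt0// mulr_gt0.
apply/ler_addgt0Pl => eta eta0.
have [e e0 He] := periodic_unif_continuous cu pu eta0.
have [del del0 Hd] := perdist_small d e0.
have base x' y' : perdist (x' - y') < del -> u x' - u y' <= eta.
  move=> /Hd[n]; rewrite addrAC => /He; rewrite pu => /ltW; exact: le_trans (ler_norm _).
(* Induction on the number [j] of halvings that bring the scale [s] below sqrt [del], where uniform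
   continuity takes over with error [eta]. A step costs N s^2 = 2 G s, and these costs sum
   geometrically to at most 4 G s. *)
have iter (j : nat) : forall (s : R) x' y', 0 < s -> s <= 2 * G / N0 -> s ^+ 2 < 4 ^+ j * del ->
    perdist (x' - y') <= s ^+ 2 -> u x' - u y' <= eta + 4 * G * s.
  elim: j => [|j IH] s x' y' s0 sr sj xys.
    rewrite expr0 mul1r in sj.
    have := base _ _ (le_lt_trans xys sj).
    have : 0 < 4 * G * s by rewrite !mulr_gt0.
    lra.
  have hN : N0 <= 2 * G / s by rewrite ler_pdivlMr// mulrC -ler_pdivlMr.
  have [a [b [ab Hab]]] := HN _ hN.
  set N := 2 * G / s in hN Hab.
  have Np : 0 < N by exact: lt_le_trans N00 hN.
  have pab1 : perdist (a - b) <= 1.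
    apply: le_trans (perdist_le _) _; rewrite -/kap.
    apply: exprn_ile1; first by rewrite mulr_ge0// ltW.
    by rewrite mulrC -ler_pdivlMr// div1r ltW.
  have [Cp Ep] := grad_perdist N b.
  have [Ht _] := perdist_pen_touch Hab.
  have := uG _ _ Cp Ht; rewrite Ep => gG.
  have pab : perdist (a - b) <= (s / 2) ^+ 2.
    have h1 : N ^+ 2 * perdist (a - b) <= G ^+ 2.
      apply: (@le_trans _ _ (enorm (N *: dperdist (a - b)) ^+ 2)).
        by rewrite enormZ_sqr; apply: ler_wpM2l; [exact: sqr_ge0 | exact: perdist_le_dperdist pab1].
      by rewrite lerXn2r// nnegrE ?enorm_ge0 // ltW.
    have -> : (s / 2) ^+ 2 = G ^+ 2 / N ^+ 2.
      by rewrite /N; field; rewrite ?gt_eqF.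
    by rewrite ler_pdivlMr ?exprn_gt0// 1?mulrC.
  have h2 : u a - u b <= eta + 4 * G * (s / 2).
    apply: IH => //; first by rewrite divr_gt0.
      by apply: le_trans sr; lra.
    have -> : (s / 2) ^+ 2 = s ^+ 2 / 4 by field.
    by rewrite ltr_pdivrMr// mulrAC -exprSr.
  have h3 := Hab x' y'.
  have h4 : N * perdist (x' - y') <= 2 * G * s.
    apply: (@le_trans _ _ (N * s ^+ 2)); first by rewrite ler_pM2l.
    by rewrite le_eqVlt; apply/orP; left; apply/eqP; rewrite /N; field; rewrite gt_eqF.
  have h5 : 0 <= N * perdist (a - b) by rewrite mulr_ge0 ?perdist_ge0// ltW.
  lra.
have [j hj] : exists j : nat, r ^+ 2 < 4 ^+ j * del.
  exists (Num.bound (r ^+ 2 / del)); rewrite -ltr_pdivrMr//.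
  apply: lt_le_trans (archi_boundP _) _; first by rewrite divr_ge0 ?sqr_ge0// ltW.
  by rewrite -natrX ler_nat ltnW// ltn_expl.
by have := iter j r x y r0 rr0 hj xyr; lra.
Qed.

(** The small-scale bound is chained along the segment from [y] to [x], cut into [n] equal pieces
    short enough for it to apply. *)
Lemma visc_grad_le_lipschitz u (G : R) : continuous u -> zperiodic u -> 0 < G ->
  visc_grad_le u G -> forall x y, u x - u y <= 4 * G * (d.+1%:R * (2 * pi)) * `|x - y|.
Proof.
move=> cu pu G0 uG x y; rewrite -/kap.
have [r0 r00 H] := visc_grad_le_small cu pu G0 uG.
have [->|xy] := eqVneq x y; first by rewrite !subrr normr0 mulr0.
have L0 : 0 < kap * `|x - y| by rewrite mulr_gt0// normr_gt0 subr_eq0.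
pose n := (Num.bound (kap * `|x - y| / r0)).+1.
have nr : kap * `|x - y| / n%:R <= r0.
  rewrite ler_pdivrMr// [leRHS]mulrC -ler_pdivrMr//.
  apply: le_trans (ltW (archi_boundP _)) _; first by rewrite divr_ge0// ltW.
  by rewrite ler_nat leqnSn.
pose r := kap * `|x - y| / n%:R; pose h := n%:R^-1 *: (x - y).
have rp : 0 < r by rewrite divr_gt0.
have step k : u (y + k%:R *: h) - u y <= k%:R * (4 * G * r).
  elim: k => [|k IH]; first by rewrite scale0r addr0 subrr mul0r.
  have := H r (y + k.+1%:R *: h) (y + k%:R *: h) rp nr.
  rewrite opprD addrACA subrr add0r -scalerBl -natrB// subSnn scale1r => Hk.
  rewrite -[in leRHS]natr1 [leRHS]mulrDl mul1r.
  have : perdist h <= r ^+ 2.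
    apply: le_trans (perdist_le _) _; rewrite -/kap /h normrZ normfV normr_nat.
    by rewrite le_eqVlt; apply/orP; left; apply/eqP; congr (_ ^+ 2); rewrite /r; ring.
  by move=> /Hk; lra.
have := step n; rewrite /h scalerA divff ?pnatr_eq0// scale1r addrCA subrr addr0.
by move=> /le_trans; apply; rewrite le_eqVlt; apply/orP; left; apply/eqP;
  rewrite /r; field; rewrite pnatr_eq0.
Qed.

(** Comparison for two scalar equations whose Hamiltonians differ by up to [theta]. At the doubled
    maximum both test functions have the same gradient, so the bound [P] coming from [u] places it
    where [H1] and [H2] can be compared. The point obtained maximizes u - w only up to [e]. *)
Lemma doubling_compare u w (H1 H2 : vec -> vec -> R) (g1 g2 : vec -> R) (theta P : R) :
  continuous u -> zperiodic u -> continuous w -> zperiodic w ->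
  visc_grad_le u P ->
  (forall phi x0, C1_torus phi -> (forall y, u y - phi y <= u x0 - phi x0) ->
     H1 x0 (grad phi x0) <= g1 x0) ->
  (forall phi y0, C1_torus phi -> (forall y, w y0 - phi y0 <= w y - phi y) ->
     g2 y0 <= H2 y0 (grad phi y0)) ->
  (forall e, 0 < e -> exists2 r, 0 < r & forall x y p, `|x - y| < r -> enorm p <= P ->
     H2 y p <= H1 x p + theta + e) ->
  (forall e, 0 < e -> exists2 r, 0 < r & forall x y, `|x - y| < r -> g2 x <= g2 y + e) ->
  forall e, 0 < e ->
  exists x, (forall z, u z - w z <= u x - w x + e) /\ g2 x <= g1 x + theta + e.
Proof.
move=> cu pu cw pw uP sub super HH gg e e0.
have e2 : 0 < e / 2 by lra.
have [r1 r10 Hw] := periodic_unif_continuous cw pw e0.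
have [r2 r20 {}HH] := HH _ e2.
have [r3 r30 {}gg] := gg _ e2.
pose r := Num.min r1 (Num.min r2 r3).
have r0 : 0 < r by rewrite !lt_min r10 r20.
have [N0 N00 /(_ _ (lexx _))[x [y [xy Hxy]]]] := doubling_max cu pu cw pw r0.
move: xy; rewrite !lt_min => /and3P[xy1 xy2 xy3].
have [Cx Ex] := grad_perdist N0 y; have [Cy Ey] := grad_perdist (- N0) x.
have [Hx Hy] := perdist_pen_touch Hxy.
have := uP _ _ Cx Hx; have := sub _ _ Cx Hx; rewrite Ex => s1 p1.
(* [dperdist] is odd, so the penalty seen from [w] has the same gradient as the one seen from
   [u]. *)
have := super _ _ Cy Hy; rewrite Ey -opprB dperdistN scalerN scaleNr opprK => s2.
exists x; split=> [z|].
  have := Hxy z z; rewrite subrr perdist0 mulr0 => h1.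
  have h2 : 0 <= N0 * perdist (x - y) by rewrite mulr_ge0 ?perdist_ge0// ltW.
  by have := Hw _ _ xy1; rewrite ltr_norml => /andP[]; lra.
by have := HH _ _ _ xy2 p1; have := gg _ _ xy3; lra.
Qed.

End Periodic.
Lemma continuous_pair (X Y Z : topologicalType) (f : X -> Y) (g : X -> Z) :
  continuous f -> continuous g -> continuous (fun x => (f x, g x)).
Proof. by move=> cf cg x; apply: cvg_pair; [exact: cf | exact: cg]. Qed.

(** * Integrals over an interval of length one *)

Section UnitIntegral.
Variables (R : realType) (a : R).
Implicit Types (h : R -> R) (c : R).

Let J h := Rintegral (@lebesgue_measure R) `[a, a + 1]%classic h.

Let in_itvE t : `[a, a + 1]%classic t <-> inI a t.
Proof. by rewrite /= in_itv. Qed.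

Lemma Rintegral_clamp h : J h = J (fun t => h (clamp a t)).
Proof.
by apply: eq_Rintegral => t; rewrite inE => /in_itvE ta; rewrite clamp_id.
Qed.

(** The length of the interval being one, [c] is its own integral; truncation makes the integrands
    continuous, hence integrable. *)
Lemma Rintegral_subr_ge h1 h2 c :
  continuous (fun t => h1 (clamp a t)) -> continuous (fun t => h2 (clamp a t)) ->
  (forall t, inI a t -> c <= h1 t - h2 t) -> c <= J h1 - J h2.
Proof.
move=> c1 c2 H; rewrite (Rintegral_clamp h1) (Rintegral_clamp h2).
have I h : continuous h -> (@lebesgue_measure R).-integrable `[a, a + 1]%classic (EFin \o h).
  move=> ch; apply: continuous_compact_integrable; first exact: segment_compact.
  exact: continuous_subspaceT.
rewrite /J -RintegralB//; try exact: I.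
have -> : c = J (cst c).
  rewrite /J Rintegral_cst//= lebesgue_measure_itv/= lte_fin ltrDl ltr01 -EFinB/=.
  by rewrite addrAC subrr add0r mulr1.
apply: le_Rintegral => //.
- by apply: I; exact: cst_continuous.
- by apply: I; exact: continuous_sub.
- by move=> t /in_itvE ta; apply: H; exact: inI_clamp.
Qed.

End UnitIntegral.

(** * Continuous functions on the torus times the interval *)

Section TorusTimesInterval.
Variables (R : realType) (d : nat) (a : R).
Notation vec := 'rV[R]_d.
Implicit Types (v w : vec -> R -> R) (x y : vec) (xi eta : R).

Lemma inI_left : inI a a.
Proof. by rewrite /inI lexx lerDl ler01. Qed.

Lemma C_TI_continuous v : C_TI a v ->
  continuous (fun p : vec * R => v p.1 (clamp a p.2)).
Proof.
move=> [_ cv].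
apply: (@within_continuous_precomp _ _ _ _ (fun p => v p.1 p.2)
  (fun p : vec * R => (p.1, clamp a p.2)) _ _ cv) => [|p /=]; last exact: inI_clamp.
apply: continuous_pair => p; first exact: cvg_fst.
by apply: (continuous_comp cvg_snd); exact: continuous_clamp.
Qed.

Lemma C_TI_continuousl v xi : C_TI a v -> inI a xi -> continuous (v ^~ xi).
Proof.
move=> cv xiI x; have := C_TI_continuous cv => /(_ (x, xi))/= H.
have -> : v ^~ xi = (fun p => v p.1 (clamp a p.2)) \o (fun y => (y, xi)).
  by apply/funext => y /=; rewrite clamp_id.
apply: continuous_comp => //; apply: continuous_pair => [z|]; first exact: cvg_id.
exact: cst_continuous.
Qed.

Lemma C_TI_continuousr v x : C_TI a v -> continuous (fun t => v x (clamp a t)).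
Proof.
move=> cv t; have := C_TI_continuous cv => /(_ (x, t))/= H.
apply: (@continuous_comp _ _ _ (fun t => (x, t)) (fun p => v p.1 (clamp a p.2))) => //.
by apply: continuous_pair => [|s]; [exact: cst_continuous | exact: cvg_id].
Qed.

Lemma compact_box_itv : compact (@unit_box R d `*` `[a, a + 1]%classic).
Proof. by apply: compact_setX; [exact: compact_unit_box | exact: segment_compact]. Qed.

Lemma C_TI_max v : C_TI a v ->
  exists x0 xi0, inI a xi0 /\ forall x xi, inI a xi -> v x xi <= v x0 xi0.
Proof.
move=> cv; have [pv _] := cv.
have [||[x0 t0] /= [_ tI] H] := max_of_compact_orbits compact_box_itv (C_TI_continuous cv).
- by exists (0, a); split; [exact: unit_box0 | rewrite /= in_itv; exact: inI_left].
- move=> [x t]; have [n nx] := unit_box_shift x.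
  exists (x + zvec R n, clamp a t) => /=.
    by split => //=; rewrite in_itv/=; exact: inI_clamp.
  by rewrite pv (@clamp_id _ a (clamp a t)) //; exact: inI_clamp.
exists x0, t0; rewrite /= in_itv/= in tI; split=> // x xi xiI.
by have := H (x, xi); rewrite /= !clamp_id.
Qed.

Lemma C_TI_unif_continuous v : C_TI a v -> forall e : R, 0 < e -> exists2 r : R, 0 < r &
  forall x y xi eta, inI a xi -> inI a eta -> `|x - y| < r -> `|xi - eta| < r ->
    `|v x xi - v y eta| < e.
Proof.
move=> cv e e0; have [pv _] := cv.
have [r r0 H] := compact_unif_continuous compact_box_itv (C_TI_continuous cv) e0.
exists r => // x y xi eta xiI etaI xy xe; have [n nx] := unit_box_shift x.
have := H (x + zvec R n, xi) (y + zvec R n, eta); rewrite /= !clamp_id// !pv; apply.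
  by split=> //=; rewrite in_itv.
by rewrite prod_normE/= gt_max opprD addrACA subrr addr0 xy.
Qed.

Lemma C_TI_intro v : (forall xi, zperiodic (v ^~ xi)) ->
  (forall e : R, 0 < e -> exists2 r : R, 0 < r & forall x y xi eta,
    inI a xi -> inI a eta -> `|x - y| < r -> `|xi - eta| < r -> `|v x xi - v y eta| <= e) ->
  C_TI a v.
Proof.
move=> pv H; split=> //.
apply/subspace_continuousP => -[x xi] /= xiI; apply/cvgrPdist_le => e e0.
have [r r0 Hr] := H _ e0.
rewrite near_withinE; exists ([set y | `|x - y| < r], [set eta | `|xi - eta| < r]) => /=.
  by split; [apply: filterS (nbhsx_ballx x r r0) => y |
             apply: filterS (nbhsx_ballx xi r r0) => eta]; rewrite -ball_normE.
by move=> [y eta] /= [xy xe] etaI; exact: Hr.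
Qed.

(** * The nonlocal operator *)

Section Kernel.
Variables (k : R -> R -> R) (k0 k1 : R).
Hypothesis hkc : {within [set q : R * R | inI a q.1 /\ inI a q.2],
  continuous (fun q => k q.1 q.2)}.
Hypothesis hk0 : 0 < k0.
Hypothesis hkb : forall xi eta, inI a xi -> inI a eta -> k0 <= k xi eta <= k1.

Lemma kernel_ub_gt0 : 0 < k1.
Proof. by have /andP[h1 h2] := hkb inI_left inI_left; exact: lt_le_trans hk0 (le_trans h1 h2). Qed.

Lemma kernel_continuous : continuous (fun q : R * R => k (clamp a q.1) (clamp a q.2)).
Proof.
apply: (@within_continuous_precomp _ _ _ _ (fun q => k q.1 q.2)
  (fun q : R * R => (clamp a q.1, clamp a q.2)) _ _ hkc) => [|q /=].
  apply: continuous_pair => q; first by apply: (continuous_comp cvg_fst); exact: continuous_clamp.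
  by apply: (continuous_comp cvg_snd); exact: continuous_clamp.
by split; exact: inI_clamp.
Qed.

Lemma kernel_unif_continuous (e : R) : 0 < e -> exists2 r : R, 0 < r &
  forall xi xi' eta, inI a xi -> inI a xi' -> inI a eta -> `|xi - xi'| < r ->
    `|k xi eta - k xi' eta| < e.
Proof.
move=> e0; have [r r0 H] := compact_unif_continuous
  (compact_setX (@segment_compact R a (a + 1)) (@segment_compact R a (a + 1)))
  kernel_continuous e0.
exists r => // xi xi' eta h1 h2 h3 xx.
have := H (xi, eta) (xi', eta); rewrite /= !clamp_id//; apply.
  by split; rewrite /= in_itv.
by rewrite prod_normE/= subrr normr0 gt_max xx.
Qed.

Lemma nonloc_integrand_continuous v x xi : C_TI a v -> inI a xi ->
  continuous (fun t => k xi (clamp a t) * (v x xi - v x (clamp a t))).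
Proof.
move=> cv xiI.
have c1 : continuous (fun t => k xi (clamp a t)).
  move=> t; have := kernel_continuous => /(_ (xi, t)) H.
  have -> : (fun t => k xi (clamp a t)) =
      (fun q => k (clamp a q.1) (clamp a q.2)) \o (fun t => (xi, t)).
    by apply/funext => s /=; rewrite (clamp_id xiI).
  apply: continuous_comp => //.
  by apply: continuous_pair => [|s]; [exact: cst_continuous | exact: cvg_id].
have c2 : continuous (fun t => v x xi - v x (clamp a t)).
  by apply: continuous_sub; [exact: cst_continuous | exact: C_TI_continuousr].
by move=> t; have := @continuousM _ _ _ _ t (c1 t) (c2 t).
Qed.

(** The maximum principle for the nonlocal term, with slack: if [xi] maximizes the difference over
    the interval up to [c], at most [k1 * c] is lost. *)
Lemma nonloc_sub_ge v w x y xi (c : R) : C_TI a v -> C_TI a w -> inI a xi -> 0 <= c ->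
  (forall eta, inI a eta -> - c <= (v x xi - w y xi) - (v x eta - w y eta)) ->
  - (k1 * c) <= nonloc a k v x xi - nonloc a k w y xi.
Proof.
move=> cv cw xiI c0 H; apply: Rintegral_subr_ge; try exact: nonloc_integrand_continuous.
move=> t tI; have Ht := H t tI; have /andP[h1 h2] := hkb xiI tI.
have K0 : 0 <= k xi t by apply: le_trans h1; exact: ltW.
rewrite /= -[leRHS]mulrBr.
apply: (@le_trans _ _ (k xi t * (- c))).
  by rewrite mulrN lerN2 ler_wpM2r.
by apply: ler_wpM2l => //; lra.
Qed.

Lemma nonloc0 x xi : nonloc a k (fun _ _ => 0) x xi = 0.
Proof.
rewrite /nonloc; under eq_Rintegral do rewrite subrr mulr0.
by rewrite Rintegral_cst// mul0r.
Qed.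

Lemma C_TI0 : C_TI a (fun (_ : vec) _ => 0 : R).
Proof. by split=> // p; exact: cst_continuous. Qed.

Lemma nonloc_ge v x xi (c : R) : C_TI a v -> inI a xi -> 0 <= c ->
  (forall eta, inI a eta -> - c <= v x xi - v x eta) -> - (k1 * c) <= nonloc a k v x xi.
Proof.
move=> cv xiI c0 H; rewrite -[leRHS]subr0 -(nonloc0 x xi).
by apply: nonloc_sub_ge => // [|eta etaI]; [exact: C_TI0 | rewrite !subr0; exact: H].
Qed.

Lemma nonloc_le0 v x xi : C_TI a v -> inI a xi ->
  (forall eta, inI a eta -> v x xi <= v x eta) -> nonloc a k v x xi <= 0.
Proof.
move=> cv xiI H.
have := @nonloc_sub_ge (fun _ _ => 0) v x x xi 0 C_TI0 cv xiI (lexx _).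
rewrite nonloc0 mulr0 !oppr0 => H0.
have : 0 <= 0 - nonloc a k v x xi by apply: H0 => eta /H; lra.
lra.
Qed.

(** The integrands differ by k(xi, t) (v(xi) - v(xi')) plus (k(xi, t) - k(xi', t)) (v(xi') - v(t)).
    The first part is the zeroth order term with coefficient at least [k0], the second is an
    error. *)
Lemma nonloc_sub_xi_ge v x xi xi' (e M : R) : C_TI a v -> inI a xi -> inI a xi' ->
  v x xi' <= v x xi -> (forall eta, inI a eta -> `|v x xi' - v x eta| <= M) ->
  (forall eta, inI a eta -> `|k xi eta - k xi' eta| <= e) ->
  k0 * (v x xi - v x xi') - e * M <= nonloc a k v x xi - nonloc a k v x xi'.
Proof.
move=> cv xiI xiI' le HM He; apply: Rintegral_subr_ge; try exact: nonloc_integrand_continuous.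
move=> t tI; have /andP[h1 h2] := hkb xiI tI.
have : `|(k xi t - k xi' t) * (v x xi' - v x t)| <= e * M.
  by rewrite normrM ler_pM//; [exact: He | exact: HM].
rewrite ler_norml => /andP[h3 _].
have : k0 * (v x xi - v x xi') <= k xi t * (v x xi - v x xi') by rewrite ler_wpM2r// subr_ge0.
lra.
Qed.

Lemma nonloc_dist_le v w x y xi (c : R) : C_TI a v -> C_TI a w -> inI a xi -> 0 <= c ->
  (forall eta, inI a eta -> `|v x eta - w y eta| <= c) ->
  `|nonloc a k v x xi - nonloc a k w y xi| <= k1 * (2 * c).
Proof.
move=> cv cw xiI c0 H; have c20 : 0 <= 2 * c by lra.
rewrite ler_norml; apply/andP; split.
  apply: nonloc_sub_ge => // eta etaI.
  have := H _ xiI; have := H _ etaI; rewrite !ler_norml => /andP[? ?] /andP[? ?]; lra.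
rewrite -lerN2 opprB; apply: nonloc_sub_ge => // eta etaI.
have := H _ xiI; have := H _ etaI; rewrite !ler_norml => /andP[? ?] /andP[? ?]; lra.
Qed.

Lemma nonloc_unif_continuous v xi : C_TI a v -> inI a xi ->
  forall e : R, 0 < e -> exists2 r : R, 0 < r &
  forall x y, `|x - y| < r -> `|nonloc a k v x xi - nonloc a k v y xi| < e.
Proof.
move=> cv xiI e e0; have k10 := kernel_ub_gt0.
have c0 : 0 < e / (4 * k1) by rewrite divr_gt0// mulr_gt0.
have [r r0 H] := C_TI_unif_continuous cv c0; exists r => // x y xy.
apply: le_lt_trans (nonloc_dist_le cv cv xiI (ltW c0) _) _.
  by move=> eta etaI; apply: ltW; apply: H => //; rewrite subrr normr0.
rewrite (_ : k1 * _ = e / 2); [lra | by field; rewrite gt_eqF].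
Qed.

End Kernel.
End TorusTimesInterval.

(** * The discounted equation: bounds, monotonicity in the discount, equicontinuity *)

Section ViscositySolutions.
Variables (R : realType) (d : nat) (a : R).
Notation vec := 'rV[R]_d.
Variables (F : vec -> vec -> R -> R) (f : vec -> R -> R) (k : R -> R -> R) (k0 k1 : R).
Hypothesis hFper : forall p xi, zperiodic (fun x => F x p xi).
Hypothesis hFc : {within [set q : vec * vec * R | inI a q.2],
  continuous (fun q => F q.1.1 q.1.2 q.2)}.
Hypothesis hf : C_TI a f.
Hypothesis hkc : {within [set q : R * R | inI a q.1 /\ inI a q.2],
  continuous (fun q => k q.1 q.2)}.
Hypothesis hk0 : 0 < k0.
Hypothesis hkb : forall xi eta, inI a xi -> inI a eta -> k0 <= k xi eta <= k1.
Hypothesis hA1 : A1 a F.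
Hypothesis hA2 : A2 a f.
Hypothesis hA4 : A4 a F.
Implicit Types (x y : vec) (v w : vec -> R -> R) (alpha beta xi : R).

Let k1_gt0 : 0 < k1.
Proof. exact: (kernel_ub_gt0 hk0 hkb). Qed.

Lemma C_TI_sub v w : C_TI a v -> C_TI a w -> C_TI a (fun x xi => v x xi - w x xi).
Proof.
move=> cv cw; apply: C_TI_intro => [xi x n|e e0].
  by rewrite (proj1 cv) (proj1 cw).
have e2 : 0 < e / 2 by lra.
have [r r0 Hr] := C_TI_unif_continuous cv e2.
have [s s0 Hs] := C_TI_unif_continuous cw e2.
exists (Num.min r s); first by rewrite lt_min r0.
move=> x y xi eta xiI etaI; rewrite !lt_min => /andP[h1 h2] /andP[h3 h4].
have := Hr _ _ _ _ xiI etaI h1 h3; have := Hs _ _ _ _ xiI etaI h2 h4.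
by rewrite ler_norml !ltr_norml => /andP[? ?] /andP[? ?]; apply/andP; split; lra.
Qed.

(** [t0] is where C1 t^(m - 1) = L. Beyond it C1 t^m dominates L t, and before it L t is at most L
    t0. *)
Lemma A1_superlinear (L : R) : 0 < L -> exists2 T : R, 0 < T &
  forall x p xi, inI a xi -> L * enorm p - T <= F x p xi.
Proof.
move=> L0; have [C1 [C2 [m [C10 [C20 [m1 H]]]]]] := hA1.
have m10 : 0 < m - 1 by lra.
pose t0 := (L / C1) `^ ((m - 1)^-1).
have t00 : 0 < t0 by rewrite powR_gt0// divr_gt0.
exists (C2 + L * t0) => [|x p xi xiI]; first by rewrite addr_gt0// mulr_gt0.
apply: le_trans (H x p xi xiI); have := enorm_ge0 p; move: (enorm p) => t tge0.
have h : 0 <= C1 * t `^ m by rewrite mulr_ge0 ?powR_ge0// ltW.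
have [tt0|tt0] := leP t t0.
  have : L * t <= L * t0 by rewrite ler_pM2l.
  lra.
have tp : 0 < t by exact: lt_trans tt0.
have -> : t `^ m = t `^ (m - 1) * t.
  transitivity (t `^ (m - 1) * t `^ 1); last by rewrite powRr1.
  by rewrite -powRD ?subrK// (gt_eqF tp) implybT.
have h2 : L / C1 <= t `^ (m - 1).
  have <- : t0 `^ (m - 1) = L / C1.
    by rewrite -powRrM mulVf ?gt_eqF// powRr1// divr_ge0// ltW.
  by apply: ge0_ler_powR; rewrite ?nnegrE ltW.
have h3 : L * t <= C1 * (t `^ (m - 1) * t).
  rewrite mulrA ler_pM2r//; move: h2; rewrite ler_pdivrMr// mulrC; exact.
have : 0 <= L * t0 by rewrite mulr_ge0 ?ltW.
lra.
Qed.

(** Bounded gradients lie in a compact cube. The modulus covers [xi] too, since equations at two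
    values of [xi] will be compared. *)
Lemma F_unif_continuous (P e : R) : 0 < e -> exists2 r : R, 0 < r &
  forall x y p xi eta, inI a xi -> inI a eta -> enorm p <= P -> `|x - y| < r ->
    `|xi - eta| < r -> `|F x p xi - F y p eta| < e.
Proof.
move=> e0.
have cF : continuous (fun q : vec * vec * R => F q.1.1 q.1.2 (clamp a q.2)).
  apply: (@within_continuous_precomp _ _ _ _ (fun q => F q.1.1 q.1.2 q.2)
    (fun q : vec * vec * R => (q.1, clamp a q.2)) _ _ hFc) => [|q /=]; last exact: inI_clamp.
  apply: continuous_pair => p; first exact: cvg_fst.
  by apply: (continuous_comp cvg_snd); exact: continuous_clamp.
have cK : compact ((@unit_box R d `*` [set p : vec | forall i, `[- P, P]%classic (p ord0 i)])
    `*` `[a, a + 1]%classic).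
  apply: compact_setX; last exact: segment_compact.
  apply: compact_setX; first exact: compact_unit_box.
  by apply: (@rV_compact R d (fun=> `[- P, P]%classic)) => i; exact: segment_compact.
have [r r0 H] := compact_unif_continuous cK cF e0.
exists r => // x y p xi eta xiI etaI pP xy xe; have [n nx] := unit_box_shift x.
have := H (x + zvec R n, p, xi) (y + zvec R n, p, eta).
rewrite /= !clamp_id// !(hFper _ _ _ n); apply.
  split=> /=; last by rewrite in_itv.
  split=> //= i; rewrite /= in_itv/= -ler_norml.
  exact: le_trans (norm_coord_enorm _ _) pP.
by rewrite !prod_normE/= !gt_max opprD addrACA !subrr addr0 normr0 xy r0.
Qed.

Lemma C1_torus_cst0 : C1_torus (fun _ : vec => 0 : R) /\
  forall x, grad (fun _ : vec => 0 : R) x = 0.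
Proof.
have [C E] := @grad_perdist R d 0 0.
have e : (fun y : vec => 0 * perdist (y - 0)) = (fun _ => 0 : R).
  by apply/funext => y; rewrite mul0r.
by rewrite e in C E; split=> // x; rewrite E scale0r.
Qed.

(** With the discount and nonlocal terms frozen, [v] solves at each [xi] the scalar equation F(x,
    Dv, xi) = [resid]. *)
Definition resid alpha v xi x := f x xi - alpha * v x xi - nonloc a k v x xi.

Lemma visc_sub_max alpha v xi phi x0 : visc_sub a alpha F k f v -> inI a xi ->
  C1_torus phi -> (forall y, v y xi - phi y <= v x0 xi - phi x0) ->
  F x0 (grad phi x0) xi <= resid alpha v xi x0.
Proof.
move=> sub xiI C1 H; have h := sub xi phi x0 xiI C1.
by rewrite /resid -addrA -opprD lerBrDr addrCA addrA; apply: h; exact: filterE.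
Qed.

Lemma visc_super_min alpha v xi phi x0 : visc_super a alpha F k f v -> inI a xi ->
  C1_torus phi -> (forall y, v x0 xi - phi x0 <= v y xi - phi y) ->
  resid alpha v xi x0 <= F x0 (grad phi x0) xi.
Proof.
move=> sup xiI C1 H; have h := sup xi phi x0 xiI C1.
by rewrite /resid -addrA -opprD lerBlDr addrCA addrA; apply: h; exact: filterE.
Qed.

Lemma resid_unif_continuous alpha v xi : C_TI a v -> inI a xi ->
  forall e : R, 0 < e -> exists2 r : R, 0 < r &
  forall x y, `|x - y| < r -> `|resid alpha v xi x - resid alpha v xi y| < e.
Proof.
move=> cv xiI e e0; have e3 : 0 < e / 3 by lra.
have e4 : 0 < e / 3 / (`|alpha| + 1) by rewrite divr_gt0// ltr_wpDl.
have [r1 r10 H1] := C_TI_unif_continuous hf e3.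
have [r2 r20 H2] := C_TI_unif_continuous cv e4.
have [r3 r30 H3] := nonloc_unif_continuous hkc hk0 hkb cv xiI e3.
exists (Num.min r1 (Num.min r2 r3)) => [|x y]; first by rewrite !lt_min r10 r20.
rewrite !lt_min => /and3P[xy1 xy2 xy3].
have s0 (r : R) : 0 < r -> `|xi - xi| < r by rewrite subrr normr0.
have h1 := H1 x y xi xi xiI xiI xy1 (s0 _ r10).
have h2 := H2 x y xi xi xiI xiI xy2 (s0 _ r20).
have h3 := H3 x y xy3.
have h4 : `|alpha * (v x xi - v y xi)| <= e / 3.
  rewrite normrM; apply: (@le_trans _ _ ((`|alpha| + 1) * `|v x xi - v y xi|)).
    by rewrite ler_wpM2r// lerDl.
  by move: (ltW h2); rewrite ler_pdivlMr ?ltr_wpDl// mulrC.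
move: h1 h3 h4; rewrite /resid ler_norml !ltr_norml => /andP[? ?] /andP[? ?] /andP[? ?].
by apply/andP; split; lra.
Qed.

(** At a global minimum over both variables the zero test function gives F = 0, while the nonlocal
    term is at most 0 and f >= 0. *)
Lemma sol_ge0 alpha v x xi : 0 < alpha -> visc_sol a alpha F k f v -> inI a xi -> 0 <= v x xi.
Proof.
move=> al0 [cv [_ sup]] xiI.
have [x0 [t0 [tI Hm]]] := C_TI_max (C_TI_sub (C_TI0 d a) cv).
have {}Hm y eta : inI a eta -> v x0 t0 <= v y eta by move=> /(Hm y); lra.
have [C0 E0] := C1_torus_cst0.
have := visc_super_min sup tI C0 (x0 := x0); rewrite E0 (proj2 (hA4 x0 0 tI)) /resid => h.
have := h (fun y => _); rewrite !subr0 => {}h.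
have {}h : f x0 t0 - alpha * v x0 t0 - nonloc a k v x0 t0 <= 0.
  by apply: h => y; rewrite !subr0; exact: Hm.
have := nonloc_le0 hkc hk0 hkb (x := x0) cv tI (fun eta etaI => Hm x0 eta etaI).
have := proj1 hA2 x0 t0 tI => h1 h2.
apply: le_trans (Hm x xi xiI); rewrite -(pmulr_rge0 _ al0); lra.
Qed.

(** Points touched from above by an admissible test function are dense: a heavy enough penalty
    centred at [x0] keeps the maximum close to it. *)
Lemma penalized_max (u : vec -> R) x0 : continuous u -> zperiodic u ->
  forall e : R, 0 < e -> exists N x1, `|x1 - x0| < e /\
    forall y, u y - N * perdist (y - x0) <= u x1 - N * perdist (x1 - x0).
Proof.
move=> cu pu e e0.
have [c c0 Hc] := perdist_small d e0.
have [z Hz] := periodic_max cu pu.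
have D0 : 0 < u z - u x0 + 1 by have := Hz x0; lra.
pose N := (u z - u x0 + 1) / c.
have N0 : 0 < N by rewrite divr_gt0.
have [||x1 H1] := @periodic_max _ _ (fun y => u y - N * perdist (y - x0)).
- apply: continuous_sub => //; apply: continuous_mull => y.
  apply: (@continuous_comp _ _ _ (fun y => y - x0)); last exact: continuous_perdist.
  by apply: (continuous_sub (h := id) (k := cst x0)) => [t|]; [exact: cvg_id | exact: cst_continuous].
- by move=> y n; rewrite pu addrAC perdistDz.
have /Hc[n Hn] : perdist (x1 - x0) < c.
  have := H1 x0; rewrite subrr perdist0 mulr0 => h.
  have Nc : N * c = u z - u x0 + 1 by rewrite /N divfK// gt_eqF.
  by rewrite -(ltr_pM2l N0); have := Hz x1; lra.
exists N, (x1 + zvec R n); split; first by rewrite addrAC.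
by move=> y; rewrite pu (addrAC x1) perdistDz.
Qed.

(* [F >= 0] kills the gradient at points touched from above, and these are dense. *)
Lemma resid_ge0 alpha v x xi : visc_sol a alpha F k f v -> inI a xi -> 0 <= resid alpha v xi x.
Proof.
move=> [cv [sub _]] xiI; apply/ler_addgt0Pl => e e0.
have [r r0 Hr] := resid_unif_continuous alpha cv xiI e0.
have [N [x1 [x1x H1]]] := penalized_max x (C_TI_continuousl cv xiI) (proj1 cv xi) r0.
have [C _] := grad_perdist N x.
have h1 := visc_sub_max sub xiI C H1; have h2 := proj1 (hA4 x1 (grad (fun y => N * perdist (y - x)) x1) xiI).
by have := Hr _ _ x1x; rewrite ltr_norml => /andP[]; lra.
Qed.

(** At the maximum over the interval of the slice above [xA] the nonlocal term is nonnegative, so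
    [resid_ge0] with f = 0 leaves alpha v <= 0. *)
Lemma sol_eq0 alpha v xA xi : 0 < alpha -> visc_sol a alpha F k f v ->
  (forall eta, inI a eta -> f xA eta = 0) -> inI a xi -> v xA xi = 0.
Proof.
move=> al0 sv HA xiI; have [cv _] := sv.
apply/eqP; rewrite eq_le (sol_ge0 _ al0 sv xiI) andbT.
have [||t0 tI Hm] := max_of_compact_orbits (@segment_compact R a (a + 1)) (C_TI_continuousr (x := xA) cv).
- by exists a; rewrite /= in_itv; exact: inI_left.
- move=> t; exists (clamp a t); first by rewrite /= in_itv; exact: inI_clamp.
  by rewrite (@clamp_id _ a (clamp a t))//; exact: inI_clamp.
rewrite /= in_itv/= in tI.
have {}Hm eta : inI a eta -> v xA eta <= v xA t0.
  by move=> etaI; have := Hm eta; rewrite !clamp_id.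
apply: le_trans (Hm xi xiI) _.
have := resid_ge0 xA sv tI; rewrite /resid HA//.
have : 0 <= nonloc a k v xA t0.
  rewrite -[leLHS]oppr0 -(mulr0 k1); apply: (nonloc_ge hkc hk0 hkb cv tI) => // eta etaI.
  by rewrite oppr0 subr_ge0 Hm.
by move=> h1 h2; rewrite -(pmulr_rle0 _ al0); lra.
Qed.

(** Since 0 <= v <= M, the discount term is nonnegative and the nonlocal term is at least -k1 M. The
    resulting bound is independent of [alpha]. *)
Lemma sol_grad_le alpha v xi (L T B M : R) : 0 < alpha -> visc_sol a alpha F k f v ->
  0 < L -> (forall x p xi, inI a xi -> L * enorm p - T <= F x p xi) ->
  (forall x xi, inI a xi -> f x xi <= B) -> (forall x xi, inI a xi -> v x xi <= M) ->
  inI a xi -> visc_grad_le (v ^~ xi) ((T + B + k1 * M) / L).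
Proof.
move=> al0 sv L0 HT HB HM xiI phi x0 C1 H; have [cv [sub _]] := sv.
have v0 eta : inI a eta -> 0 <= v x0 eta by exact: (sol_ge0 x0 al0 sv).
have M0 : 0 <= M by apply: le_trans (v0 _ xiI) (HM _ _ xiI).
have h1 := visc_sub_max sub xiI C1 H; have h2 := HT x0 (grad phi x0) xi xiI.
have h3 : - (k1 * M) <= nonloc a k v x0 xi.
  apply: (nonloc_ge hkc hk0 hkb cv xiI M0) => eta etaI.
  by have := v0 _ xiI; have := HM x0 _ etaI; lra.
have h4 : 0 <= alpha * v x0 xi by rewrite mulr_ge0 ?v0// ltW.
have h5 := HB x0 _ xiI.
by rewrite ler_pdivlMr// mulrC; move: h1; rewrite /resid; lra.
Qed.

(* [v] vanishes on the zero set of [f] and is Lipschitz with constant O((1 + max v) / L) for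
   every [L], by superlinearity: for [L] large this bounds [max v]. *)
Lemma sol_uniform_bounds : exists M G : R, [/\ 0 <= M, 0 < G &
  forall alpha v, 0 < alpha -> visc_sol a alpha F k f v ->
    (forall x xi, inI a xi -> v x xi <= M) /\
    (forall xi, inI a xi -> visc_grad_le (v ^~ xi) G)].
Proof.
have [xB [tB [tBI HB]]] := C_TI_max hf; set B := f xB tB in HB.
have B0 : 0 <= B by exact: (proj1 hA2).
pose kap : R := d.+1%:R * (2 * pi).
have kap0 : 0 < kap by rewrite !mulr_gt0// pi_gt0.
(* [L] makes the coefficient of max v in the Lipschitz estimate equal to 1/2; [M] is then chosen so
   that the estimate reads m <= M / 2 + m / 2. *)
pose L := 8 * kap * k1; have L0 : 0 < L by do 2 apply: mulr_gt0 => //.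
have [T T0 HT] := A1_superlinear L0.
have [xA HA] := proj2 hA2.
pose M := 8 * kap * (T + B) / L; pose G := (T + B + k1 * M) / L.
have TB : 0 < T + B by rewrite ltr_wpDr.
have M0 : 0 < M by apply: divr_gt0 => //; apply: mulr_gt0 => //; exact: mulr_gt0.
have G0 : 0 < G.
  by apply: divr_gt0 => //; apply: addr_gt0 => //; exact: mulr_gt0.
exists M, G; split => //; first exact: ltW.
move=> alpha v al0 sv; have [cv _] := sv.
suff HM x xi : inI a xi -> v x xi <= M.
  by split=> // xi xiI; exact: (sol_grad_le al0 sv L0 HT HB HM xiI).
have [x0 [t0 [tI Hm]]] := C_TI_max cv.
move=> xiI; apply: le_trans (Hm x xi xiI) _.
(* The gradient bound is first applied with the maximum of [v] itself as upper bound. *)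
have gl := sol_grad_le al0 sv L0 HT HB Hm tI.
set m := v x0 t0 in Hm gl *.
have m0 : 0 <= m by exact: (sol_ge0 _ al0 sv).
have Gm0 : 0 < (T + B + k1 * m) / L.
  by apply: divr_gt0 => //; apply: ltr_wpDr => //; apply: mulr_ge0 => //; exact: ltW.
have lip := visc_grad_le_lipschitz (C_TI_continuousl cv tI) (proj1 cv t0) Gm0 gl.
(* Periodicity brings the maximum point within distance one of [xA], where [v] vanishes. *)
have [n Hn] := ex_shift_half (x0 - xA).
have := lip (x0 + zvec R n) xA; rewrite -/kap (proj1 cv t0) (sol_eq0 al0 sv HA tI) subr0 -/m => h.
have nh : `|x0 + zvec R n - xA| <= 1.
  by apply: norm_le_coord => // i; rewrite addrAC; have := Hn i; lra.
have h2 : m <= 4 * ((T + B + k1 * m) / L) * kap.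
  apply: le_trans h _; rewrite -[leRHS]mulr1; apply: ler_wpM2l => //.
    by apply: ltW; apply: mulr_gt0 => //; exact: mulr_gt0.
have E : 4 * ((T + B + k1 * m) / L) * kap = M / 2 + m / 2.
  by rewrite /M /L; field; rewrite ?gt_eqF.
by move: h2; rewrite E; lra.
Qed.

(** Maximizing w - v over both variables selects [t0], and only the space variable is doubled there;
    maximality in [xi] orders the nonlocal terms. *)
Lemma sol_monotone alpha beta v w x xi : 0 < alpha -> alpha <= beta ->
  visc_sol a alpha F k f v -> visc_sol a beta F k f w -> inI a xi -> w x xi <= v x xi.
Proof.
move=> al0 ab sv sw xiI; have be0 : 0 < beta by exact: lt_le_trans ab.
have [cv [subv superv]] := sv; have [cw [subw superw]] := sw.
have [M [G [_ _ HG]]] := sol_uniform_bounds; have [_ Gw] := HG _ _ be0 sw.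
have [x0 [t0 [tI Hm]]] := C_TI_max (C_TI_sub cw cv).
suff : w x0 t0 - v x0 t0 <= 0 by have := Hm x xi xiI; lra.
set m := w x0 t0 - v x0 t0 in Hm *.
(* The three errors are alpha e from the approximate maximum, k1 e from the nonlocal terms and e
   from the doubling. *)
have key (e : R) : 0 < e -> alpha * m <= (alpha + k1 + 1) * e.
  move=> e0.
  have [] := @doubling_compare _ _ (w ^~ t0) (v ^~ t0) (fun x p => F x p t0) (fun x p => F x p t0)
    (resid beta w t0) (resid alpha v t0) 0 G (C_TI_continuousl cw tI) (proj1 cw t0)
    (C_TI_continuousl cv tI) (proj1 cv t0) (Gw t0 tI) _ _ _ _ e e0.
  - by move=> phi y; exact: visc_sub_max.
  - by move=> phi y; exact: visc_super_min.
  - move=> s s0; have [r r0 H] := F_unif_continuous G s0; exists r => // y z p yz pG.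
    have := H y z p t0 t0 tI tI pG yz; rewrite subrr normr0 => /(_ r0).
    by rewrite ltr_norml => /andP[]; lra.
  - move=> s s0; have [r r0 H] := resid_unif_continuous alpha cv tI s0.
    by exists r => // y z /H; rewrite ltr_norml => /andP[]; lra.
  move=> z [Hz]; rewrite addr0 /resid => Hr.
  have mz : m <= w z t0 - v z t0 + e by exact: Hz.
  have : - (k1 * e) <= nonloc a k w z t0 - nonloc a k v z t0.
    apply: (nonloc_sub_ge hkc hk0 hkb cw cv tI (ltW e0)) => eta etaI.
    by have := Hm z eta etaI; lra.
  have : alpha * w z t0 <= beta * w z t0 by rewrite ler_wpM2r// (sol_ge0 _ be0 sw).
  have : alpha * m <= alpha * (w z t0 - v z t0 + e) by rewrite ler_pM2l.
  lra.
rewrite leNgt; apply/negP => m0.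
have c0 : 0 < alpha + k1 + 1 by rewrite !addr_gt0.
have := key (alpha * m / (2 * (alpha + k1 + 1))); rewrite divr_gt0 ?mulr_gt0// => /(_ isT).
have am : 0 < alpha * m by rewrite mulr_gt0.
rewrite (_ : _ * (_ / _) = alpha * m / 2); [lra | by field; rewrite gt_eqF].
Qed.

(** The gap between the Hamiltonians at [xi] and [eta] enters as [theta]. The one-sided estimate
    suffices because [xi] and [eta] may be exchanged. *)
Lemma sol_equicontinuous_xi (e : R) : 0 < e -> exists2 r : R, 0 < r &
  forall alpha v, 0 < alpha -> visc_sol a alpha F k f v ->
  forall x xi eta, inI a xi -> inI a eta -> `|xi - eta| < r -> v x xi - v x eta <= e.
Proof.
move=> e0; have [M [G [M0 _ HG]]] := sol_uniform_bounds.
(* The bound e / 2 pays for the approximate maximum. The second entry makes the errors from F, f and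
   the doubling (s each) and from the kernel (s M) at most k0 e / 2 in total. *)
pose s := Num.min (e / 2) (e * k0 / (2 * (M + 4))).
have M4 : 0 < 2 * (M + 4) by lra.
have s0 : 0 < s by rewrite lt_min !divr_gt0// mulr_gt0.
have se : s <= e / 2 by rewrite ge_min lexx.
have sk : s * (M + 4) <= k0 * (e / 2).
  have : s <= e * k0 / (2 * (M + 4)) by rewrite ge_min lexx orbT.
  by rewrite ler_pdivlMr//; lra.
have [r1 r10 H1] := F_unif_continuous G s0.
have [r2 r20 H2] := kernel_unif_continuous hkc s0.
have [r3 r30 H3] := C_TI_unif_continuous hf s0.
exists (Num.min r1 (Num.min r2 r3)) => [|alpha v al0 sv x xi eta xiI etaI].
  by rewrite !lt_min r10 r20.
rewrite !lt_min => /and3P[xe1 xe2 xe3].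
have [cv [sub super]] := sv; have [vM vG] := HG _ _ al0 sv.
have [] := @doubling_compare _ _ (v ^~ xi) (v ^~ eta) (fun x p => F x p xi) (fun x p => F x p eta)
    (resid alpha v xi) (resid alpha v eta) s G (C_TI_continuousl cv xiI) (proj1 cv xi)
    (C_TI_continuousl cv etaI) (proj1 cv eta) (vG xi xiI) _ _ _ _ s s0.
- by move=> phi y; exact: visc_sub_max.
- by move=> phi y; exact: visc_super_min.
- move=> t t0; exists r1 => // y z p yz pG.
  by have := H1 y z p xi eta xiI etaI pG yz xe1; rewrite ltr_norml => /andP[]; lra.
- move=> t t0; have [r r0 H] := resid_unif_continuous alpha cv etaI t0.
  by exists r => // y z /H; rewrite ltr_norml => /andP[]; lra.
move=> z [Hz]; rewrite /resid => Hr.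
have := Hz x => hx.
have [D0|D0] := leP (v z xi) (v z eta); first lra.
have : k0 * (v z xi - v z eta) - s * M <= nonloc a k v z xi - nonloc a k v z eta.
  apply: (nonloc_sub_xi_ge hkc hkb cv xiI etaI (ltW D0)) => t tI.
    rewrite ler_norml; have := sol_ge0 z al0 sv tI; have := sol_ge0 z al0 sv etaI.
    by have := vM z t tI; have := vM z eta etaI => *; apply/andP; split; lra.
  by apply: ltW; exact: H2.
have : 0 <= alpha * (v z xi - v z eta) by rewrite mulr_ge0 ?subr_ge0// ltW.
have := H3 z z xi eta xiI etaI; rewrite subrr normr0 => /(_ r30 xe3).
rewrite ltr_norml => /andP[_ h1] h2 h3.
have : k0 * (v z xi - v z eta) <= k0 * (e / 2) by lra.
rewrite ler_pM2l//; lra.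
Qed.

End ViscositySolutions.

(** * Stability of viscosity solutions as the discount vanishes *)

Section VanishingDiscount.
Variables (R : realType) (d : nat) (a : R).
Notation vec := 'rV[R]_d.
Implicit Types (x y : vec) (v w : vec -> R -> R) (alpha beta xi : R).

(** Adding the penalty makes the local maximum strict, and a strict local maximum persists nearby
    under small uniform perturbations. *)
Lemma local_max_perturb (g phi : vec -> R) x0 (e : R) : continuous phi -> 0 < e ->
  (\forall y \near x0, g y - phi y <= g x0 - phi x0) ->
  exists2 c : R, 0 < c & forall h : vec -> R, continuous h -> (forall y, `|h y - g y| <= c) ->
  exists x1, `|x1 - x0| < e /\ \forall y \near x1,
    h y - (phi y + perdist (y - x0)) <= h x1 - (phi x1 + perdist (x1 - x0)).
Proof.
move=> cphi e0 /nbhs_normP[r /= r0 Hr].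
(* The cube of half-side [s] lies where [x0] is maximal and where the penalty controls the norm; t
   <= s keeps [x1] interior, so it is a genuine local maximum. *)
pose s := Num.min (r / 2) (1 / 2); pose t := Num.min e s.
have s0 : 0 < s by rewrite lt_min; apply/andP; split; lra.
have sr : s <= r / 2 by rewrite ge_min lexx.
have s2 : s <= 1 / 2 by rewrite ge_min lexx orbT.
have t0 : 0 < t by rewrite lt_min e0.
have te : t <= e by rewrite ge_min lexx.
have ts : t <= s by rewrite ge_min lexx orbT.
have [c0 c00 Hc] := perdist_small_half d t0.
(* Comparing [x1] with [x0] uses the error twice, hence perdist (x1 - x0) <= c0 / 2 < c0. *)
exists (c0 / 4) => [|h ch Hh]; first lra.
pose K := [set y : vec | forall i, `[x0 ord0 i - s, x0 ord0 i + s]%classic (y ord0 i)].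
have cK : compact K.
  apply: (@rV_compact R d (fun i => `[x0 ord0 i - s, x0 ord0 i + s]%classic)) => i.
  exact: segment_compact.
have KE y : K y <-> `|y - x0| <= s.
  split=> [H|H i]; last first.
    rewrite /= in_itv/= -ler_distl.
    by have := norm_coord (y - x0) i; rewrite !mxE => /le_trans; apply.
  apply: norm_le_coord => [|i]; first exact: ltW.
  by have := H i; rewrite /= in_itv/= -ler_distl !mxE.
pose q y := h y - (phi y + perdist (y - x0)).
have cq : continuous q.
  apply: continuous_sub => //; apply: continuous_add => // y.
  apply: (@continuous_comp _ _ _ (fun y => y - x0)); last exact: continuous_perdist.
  by apply: (continuous_sub (h := id) (k := cst x0)) => [z|]; [exact: cvg_id | exact: cst_continuous].
have K0 : K x0 by apply/KE; rewrite subrr normr0 ltW.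
have [x1 x1K Hm] := compact_EVT_max (ex_intro _ x0 K0) cK (continuous_subspaceT cq).
rewrite inE in x1K; have x1s := (KE x1).1 x1K.
have x1t : `|x1 - x0| < t.
  apply: Hc => [i|]; first exact: le_trans (norm_coord _ _) (le_trans x1s s2).
  have := Hm x0; rewrite inE => /(_ K0); rewrite /q subrr perdist0.
  have : g x1 - phi x1 <= g x0 - phi x0 by apply: Hr => /=; rewrite distrC; lra.
  have := Hh x1; have := Hh x0; rewrite !ler_norml => /andP[? ?] /andP[? ?]; lra.
exists x1; split; first lra.
apply/nbhs_normP; exists (s - `|x1 - x0|) => /=; first lra.
move=> y /= yx1; apply: Hm; rewrite inE; apply/KE.
by have := ler_distD x1 y x0; rewrite (distrC y x1); lra.
Qed.

Variables (F : vec -> vec -> R -> R) (f : vec -> R -> R) (k : R -> R -> R) (k0 k1 : R).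
Hypothesis hFc : {within [set q : vec * vec * R | inI a q.2],
  continuous (fun q => F q.1.1 q.1.2 q.2)}.
Hypothesis hf : C_TI a f.
Hypothesis hkc : {within [set q : R * R | inI a q.1 /\ inI a q.2],
  continuous (fun q => k q.1 q.2)}.
Hypothesis hk0 : 0 < k0.
Hypothesis hkb : forall xi eta, inI a xi -> inI a eta -> k0 <= k xi eta <= k1.

Lemma F_continuous_along xi (q : vec -> vec) : inI a xi -> continuous q ->
  continuous (fun x => F x (q x) xi).
Proof.
move=> xiI cq.
apply: (@within_continuous_precomp _ _ _ _ (fun q => F q.1.1 q.1.2 q.2)
    (fun x : vec => (x, q x, xi)) _ _ hFc) => //.
apply: continuous_pair; last exact: cst_continuous.
by apply: continuous_pair => // x; exact: cvg_id.
Qed.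

Lemma C1_perdist x0 : C1_torus (fun y : vec => perdist (y - x0)) /\
  forall x, grad (fun y => perdist (y - x0)) x = dperdist (x - x0).
Proof.
have [C E] := grad_perdist 1 x0.
have e : (fun y => 1 * perdist (y - x0)) = (fun y => perdist (y - x0)).
  by apply/funext => y; rewrite mul1r.
by rewrite e in C E; split=> // x; rewrite E scale1r.
Qed.

(** The undiscounted equation depends continuously on the point and, in uniform norm, on the
    function in the nonlocal term. A share e / 4 goes to each of F, f and the two changes in the
    nonlocal term. *)
Lemma equation_near_limit v phi x0 xi (e : R) : C_TI a v -> C1_torus phi -> inI a xi -> 0 < e ->
  exists r c : R, [/\ 0 < r, 0 < c & forall h x1, C_TI a h ->
    (forall y eta, inI a eta -> `|h y eta - v y eta| <= c) -> `|x1 - x0| < r ->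
    `|(F x1 (grad phi x1) xi + nonloc a k h x1 xi - f x1 xi) -
      (F x0 (grad phi x0) xi + nonloc a k v x0 xi - f x0 xi)| <= e].
Proof.
move=> cv [_ [_ cgrad]] xiI e0; have k10 := kernel_ub_gt0 hk0 hkb.
have e4 : 0 < e / 4 by lra.
have /cvgrPdist_lt/(_ _ e4)/nbhs_normP[r1 /= r10 H1] :=
  F_continuous_along xiI cgrad (x := x0).
have [r2 r20 H2] := C_TI_unif_continuous hf e4.
have [r3 r30 H3] := nonloc_unif_continuous hkc hk0 hkb cv xiI e4.
have c0 : 0 < e / (8 * k1) by rewrite divr_gt0// mulr_gt0.
exists (Num.min r1 (Num.min r2 r3)), (e / (8 * k1)); split => // [|h x1 ch Hh].
  by rewrite !lt_min r10 r20.
rewrite !lt_min => /and3P[x11 x12 x13].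
have := H1 x1; rewrite /= distrC => /(_ x11) h1.
have := H2 x1 x0 xi xi xiI xiI x12; rewrite subrr normr0 => /(_ r20) h2.
have h3 := H3 _ _ x13.
have := nonloc_dist_le hkc hk0 hkb ch cv xiI (ltW c0) (x := x1) (y := x1) (Hh x1).
rewrite (_ : k1 * _ = e / 4); last by field; rewrite gt_eqF.
move: h1 h2 h3; rewrite !ler_norml !ltr_norml.
by move=> /andP[? ?] /andP[? ?] /andP[? ?] /andP[? ?]; apply/andP; split; lra.
Qed.

Variable va : R -> vec -> R -> R.
Hypothesis hva : forall alpha, 0 < alpha -> visc_sol a alpha F k f (va alpha).
Variables (M : R).
Hypothesis vaM : forall alpha x xi, 0 < alpha -> inI a xi -> 0 <= va alpha x xi <= M.

(** The penalty has zero gradient at [x0], so it leaves the limiting inequality unchanged. The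
    discount term is dropped by sign for subsolutions and is at most [alpha * M] for
    supersolutions. *)
Lemma visc_sol_limit v : C_TI a v ->
  (forall eps, 0 < eps -> exists delta, 0 < delta /\
     forall alpha, 0 < alpha -> alpha < delta ->
       forall x xi, inI a xi -> `|va alpha x xi - v x xi| < eps) ->
  visc_sol a 0 F k f v.
Proof.
move=> cv uv.
have M0 : 0 <= M.
  by have /andP[h1 h2] := @vaM 1 0 a ltr01 (inI_left a); exact: le_trans h1 h2.
have approx (e c : R) : 0 < e -> 0 < c -> exists2 alpha, 0 < alpha & alpha * M <= e /\
    forall x xi, inI a xi -> `|va alpha x xi - v x xi| <= c.
  move=> e0 c0; have [del [del0 H]] := uv c c0.
  have M1 : 0 < M + 1 by lra.
  (* [M + 1] replaces [M], which may be zero, in the denominator. *)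
  exists (Num.min (del / 2) (e / (M + 1))).
    by rewrite lt_min !divr_gt0.
  split.
    apply: (@le_trans _ _ (e / (M + 1) * (M + 1))); last by rewrite divfK// gt_eqF.
    apply: ler_pM => //; [|by rewrite ge_min lexx orbT | lra].
    by rewrite le_min !ltW// divr_gt0.
  move=> x xi xiI; apply: ltW; apply: H => //.
    by rewrite lt_min !divr_gt0.
  apply: (@le_lt_trans _ _ (del / 2)); [by rewrite ge_min lexx | lra].
have cC (phi : vec -> R) : C1_torus phi -> continuous phi.
  by move=> [_ [dphi _]] x; exact: differentiable_continuous.
split => //; split => xi phi x0 xiI C1 Hphi; apply/ler_addgt0Pl => e e0.
- have [Cp Ep] := C1_perdist x0; have [Cpsi Epsi] := C1_torusD C1 Cp.
  have [r [c [r0 c0 Hrc]]] := equation_near_limit x0 cv Cpsi xiI e0.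
  have [c' c'0 Hc'] := local_max_perturb (g := v ^~ xi) (cC _ C1) r0 Hphi.
  have cc0 : 0 < Num.min c c' by rewrite lt_min c0.
  have [alpha al0 [_ Hal]] := approx _ _ e0 cc0.
  have [ca [sub _]] := hva al0.
  have Hc y eta : inI a eta -> `|va alpha y eta - v y eta| <= c.
    by move=> etaI; apply: le_trans (Hal y eta etaI) _; rewrite ge_min lexx.
  have [|x1 [x1r x1m]] := Hc' _ (C_TI_continuousl ca xiI).
    by move=> y; apply: le_trans (Hal y xi xiI) _; rewrite ge_min lexx orbT.
  have := sub xi _ x1 xiI Cpsi x1m.
  have := Hrc _ x1 ca Hc x1r; rewrite (Epsi x0) Ep subrr dperdist0 addr0 mul0r add0r.
  have va0 : 0 <= alpha * va alpha x1 xi.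
    by have /andP[h _] := @vaM alpha x1 xi al0 xiI; rewrite mulr_ge0// ltW.
  by rewrite ler_norml => /andP[? ?] ?; lra.
(* Negating both functions reduces the case to a local maximum; the test function becomes [phi]
   minus the penalty. *)
- have e2 : 0 < e / 2 by lra.
  have [C1' E1'] := C1_torusN C1; have [Cp Ep] := C1_perdist x0.
  have [Cs Es] := C1_torusD C1' Cp; have [Cpsi Epsi] := C1_torusN Cs.
  have [r [c [r0 c0 Hrc]]] := equation_near_limit x0 cv Cpsi xiI e2.
  have Hphi' : \forall y \near x0, - v y xi - - phi y <= - v x0 xi - - phi x0.
    by apply: filterS Hphi => y; lra.
  have [c' c'0 Hc'] := local_max_perturb (g := fun y => - v y xi) (cC _ C1') r0 Hphi'.
  have cc0 : 0 < Num.min c c' by rewrite lt_min c0.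
  have [alpha al0 [aM Hal]] := approx _ _ e2 cc0.
  have [ca [_ sup]] := hva al0.
  have Hc y eta : inI a eta -> `|va alpha y eta - v y eta| <= c.
    by move=> etaI; apply: le_trans (Hal y eta etaI) _; rewrite ge_min lexx.
  have [||x1 [x1r x1m]] := Hc' (fun y => - va alpha y xi).
  - by move=> y; apply: continuousN; exact: (C_TI_continuousl ca xiI).
  - move=> y; rewrite -opprD normrN; apply: le_trans (Hal y xi xiI) _.
    by rewrite ge_min lexx orbT.
  have x1m' : \forall y \near x1, va alpha x1 xi - - (- phi x1 + perdist (x1 - x0)) <=
      va alpha y xi - - (- phi y + perdist (y - x0)).
    by apply: filterS x1m => y; lra.
  have := sup xi _ x1 xiI Cpsi x1m'.
  have := Hrc _ x1 ca Hc x1r.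
  rewrite (Epsi x0) (Es x0) E1' Ep subrr dperdist0 addr0 opprK mul0r add0r.
  have va0 : alpha * va alpha x1 xi <= e / 2.
    apply: le_trans aM; rewrite ler_pM2l//.
    by have /andP[] := @vaM alpha x1 xi al0 xiI.
  by rewrite ler_norml => /andP[? ?] ?; lra.
Qed.

(** * The monotone limit and uniform convergence *)

Variable L : R.
Hypothesis va_mono : forall alpha beta x xi, 0 < alpha -> alpha <= beta -> inI a xi ->
  va beta x xi <= va alpha x xi.
Hypothesis va_lip : forall alpha x y xi, 0 < alpha -> inI a xi ->
  va alpha x xi - va alpha y xi <= L * `|x - y|.
Hypothesis va_equi : forall e : R, 0 < e -> exists2 r : R, 0 < r &
  forall alpha x xi eta, 0 < alpha -> inI a xi -> inI a eta -> `|xi - eta| < r ->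
    va alpha x xi - va alpha x eta <= e.

(** By monotonicity this supremum is the limit as alpha tends to 0. It is meaningful for [xi] in the
    interval and may be a default value elsewhere. *)
Let vlim x xi := sup [set va alpha x xi | alpha in [set alpha | 0 < alpha]].

Let vlim_has_sup x xi : inI a xi ->
  has_sup [set va alpha x xi | alpha in [set alpha | 0 < alpha]].
Proof.
move=> xiI; split; first by exists (va 1 x xi), 1 => //=; exact: ltr01.
by exists M => _ [alpha /= al0 <-]; have /andP[] := @vaM alpha x xi al0 xiI.
Qed.

Lemma va_le_vlim alpha x xi : 0 < alpha -> inI a xi -> va alpha x xi <= vlim x xi.
Proof. by move=> al0 xiI; apply: sup_upper_bound; [exact: vlim_has_sup | exists alpha]. Qed.

Lemma vlim_approx x xi (e : R) : 0 < e -> inI a xi ->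
  exists2 alpha, 0 < alpha & vlim x xi - e < va alpha x xi.
Proof.
move=> e0 xiI; have [_ [alpha al0 <-] H] := sup_adherent e0 (vlim_has_sup x xiI).
by exists alpha.
Qed.

(** The moduli are independent of [alpha], so they pass to the supremum. *)
Lemma va_vlim_equicontinuous (e : R) : 0 < e -> exists2 r : R, 0 < r &
  forall x y xi eta, inI a xi -> inI a eta -> `|x - y| < r -> `|xi - eta| < r ->
    (forall alpha, 0 < alpha -> va alpha x xi <= va alpha y eta + e) /\
    vlim x xi <= vlim y eta + e.
Proof.
move=> e0; have e2 : 0 < e / 2 by lra.
have [r r0 Hr] := va_equi e2.
have L1 : 0 < `|L| + 1 by rewrite ltr_wpDl.
exists (Num.min r (e / 2 / (`|L| + 1))); first by rewrite lt_min r0 divr_gt0.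
move=> x y xi eta xiI etaI; rewrite !lt_min => /andP[_ xy] /andP[xe _].
have H alpha : 0 < alpha -> va alpha x xi <= va alpha y eta + e.
  move=> al0; have := Hr alpha x xi eta al0 xiI etaI xe.
  have := @va_lip alpha x y eta al0 etaI.
  have : L * `|x - y| <= e / 2.
    move: (ltW xy); rewrite ler_pdivlMr// mulrC; apply: le_trans.
    by rewrite ler_wpM2r//; have := ler_norm L; lra.
  lra.
split=> //; apply: ge_sup; first by exists (va 1 x xi), 1 => //=; exact: ltr01.
move=> _ [alpha /= al0 <-]; have := H _ al0; have := @va_le_vlim alpha y eta al0 etaI; lra.
Qed.

Lemma vlim_C_TI : C_TI a vlim.
Proof.
apply: C_TI_intro => [xi x n|e e0].
  rewrite /vlim; congr sup; apply/seteqP; split => _ [alpha /= al0 <-];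
    exists alpha => //; by have [[pv _] _] := hva al0; rewrite pv.
have [r r0 H] := va_vlim_equicontinuous e0; exists r => // x y xi eta xiI etaI xy xe.
have [_ h1] := H x y xi eta xiI etaI xy xe.
rewrite distrC in xy; rewrite distrC in xe.
have [_ h2] := H y x eta xi etaI xiI xy xe.
by rewrite ler_norml; apply/andP; split; lra.
Qed.

(* Dini's argument: monotonicity in [alpha] makes pointwise closeness at one [alpha]
   propagate to all smaller ones, and equicontinuity to a neighbourhood. *)
Lemma va_vlim_uniform (eps : R) : 0 < eps -> exists delta : R, 0 < delta /\
  forall alpha, 0 < alpha -> alpha < delta ->
    forall x xi, inI a xi -> `|va alpha x xi - vlim x xi| < eps.
Proof.
move=> eps0; have e4 : 0 < eps / 4 by lra.
have [r r0 Hr] := va_vlim_equicontinuous e4.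
have /compact_near_coveringP/(_ _ (0^'+ : set_system R)
  (fun alpha p => 0 < alpha -> vlim p.1 (clamp a p.2) < va alpha p.1 (clamp a p.2) + eps) _)
  := @compact_box_itv R d a.
case.
  move=> [x xi] /= _.
  have tI := inI_clamp a xi; set t := clamp a xi in tI *.
  have [al0 al00 Hal0] := vlim_approx x e4 tI.
  have ct := @continuous_clamp R a xi; move/cvgrPdist_lt/(_ _ r0) : ct => ct.
  exists ([set p | `|x - p.1| < r /\ `|t - clamp a p.2| < r], [set alpha | alpha < al0]) => /=.
    split; last exact: nbhs_right_lt.
    exists ([set y | `|x - y| < r], [set eta | `|t - clamp a eta| < r]) => //=.
    split => //; by apply: filterS (nbhsx_ballx x r r0) => y; rewrite -ball_normE.
  (* Three losses of eps / 4: moving [vlim] to (x, t), replacing it by [va al0] there, and moving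
     [va alpha] back to the nearby point. *)
  move=> [[y eta] alpha] /= [[xy te] lal] alp.
  have uI := inI_clamp a eta.
  have [h1 _] := Hr x y t _ tI uI xy te.
  rewrite distrC in xy; rewrite distrC in te.
  have [_ h2] := Hr y x _ t uI tI xy te.
  have := h1 _ alp; have := va_mono x alp (ltW lal) tI; lra.
move=> del /= del0 Hdel; exists del; split=> // alpha al0 ald x xi xiI.
have [n nx] := unit_box_shift x.
have := Hdel alpha; rewrite /ball_/= sub0r normrN (gtr0_norm al0) => /(_ ald al0).
move=> /(_ (x + zvec R n, xi)) /=; rewrite (clamp_id xiI).
have [[pv _] _] := hva al0; rewrite pv (proj1 vlim_C_TI).
move=> /(_ _ al0) h; have {}h : vlim x xi < va alpha x xi + eps.
  by apply: h; split=> //=; rewrite in_itv.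
by have := @va_le_vlim alpha x xi al0 xiI; rewrite ltr_norml => ?; apply/andP; split; lra.
Qed.

Lemma vanishing_discount_limit : exists v : vec -> R -> R,
  visc_sol a 0 F k f v /\
  (forall eps, 0 < eps -> exists delta, 0 < delta /\
     forall alpha, 0 < alpha -> alpha < delta ->
       forall x xi, inI a xi -> `|va alpha x xi - v x xi| < eps).
Proof.
by exists vlim; split; [apply: visc_sol_limit vlim_C_TI _ |]; exact: va_vlim_uniform.
Qed.

End VanishingDiscount.

(** * Uniform estimates fed into the limit argument *)

Unset Implicit Arguments. Set Strict Implicit.

Theorem mainTheorem12 (R : realType) (d : nat) (a : R)
  (F : 'rV[R]_d -> 'rV[R]_d -> R -> R) (f : 'rV[R]_d -> R -> R)
  (k : R -> R -> R) (k0 k1 : R)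
  (hFper : forall p xi, zperiodic (fun x => F x p xi))
  (hFc : {within [set q : 'rV[R]_d * 'rV[R]_d * R | inI a q.2],
           continuous (fun q => F q.1.1 q.1.2 q.2)})
  (hf : C_TI a f)
  (hkc : {within [set q : R * R | inI a q.1 /\ inI a q.2],
           continuous (fun q => k q.1 q.2)})
  (hk0 : 0 < k0)
  (hkb : forall xi eta, inI a xi -> inI a eta -> k0 <= k xi eta <= k1)
  (hA1 : A1 a F) (hA2 : A2 a f) (hA3 : A3 a F) (hA4 : A4 a F) (hA5 : A5 a F f)
  (va : R -> 'rV[R]_d -> R -> R)
  (hva : forall alpha, 0 < alpha -> visc_sol a alpha F k f (va alpha)) :
  exists v : 'rV[R]_d -> R -> R,
    visc_sol a 0 F k f v /\
    (forall eps, 0 < eps -> exists delta, 0 < delta /\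
       forall alpha, 0 < alpha -> alpha < delta ->
         forall x xi, inI a xi -> `|va alpha x xi - v x xi| < eps).
Proof.
have [M [G [M0 G0 HG]]] := sol_uniform_bounds hf hkc hk0 hkb hA1 hA2 hA4.
apply: (@vanishing_discount_limit R d a F f k k0 k1 hFc hf hkc hk0 hkb va hva M _
  (4 * G * (d.+1%:R * (2 * pi)))).
- move=> alpha x xi al0 xiI; rewrite (sol_ge0 hkc hk0 hkb hA2 hA4 x al0 (hva _ al0) xiI).
  by have [-> //] := HG _ _ al0 (hva _ al0).
- move=> alpha beta x xi al0 ab xiI.
  have be0 : 0 < beta by exact: lt_le_trans ab.
  exact: (sol_monotone hFper hFc hf hkc hk0 hkb hA1 hA2 hA4 x al0 ab (hva _ al0) (hva _ be0) xiI).
- move=> alpha x y xi al0 xiI; have [cv _] := hva _ al0.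
  have [_ gv] := HG _ _ al0 (hva _ al0).
  exact: (visc_grad_le_lipschitz (C_TI_continuousl cv xiI) (proj1 cv xi) G0 (gv xi xiI)).
- move=> e e0; have [r r0 H] := sol_equicontinuous_xi hFper hFc hf hkc hk0 hkb hA1 hA2 hA4 e0.
  by exists r => // alpha x xi eta al0; exact: H (hva _ al0) _ _ _.
Qed.
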